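(* A. Let $u\in W$ with reduced decomposition $u=s_{j_l}\cdots s_{j_1}$, $\alpha^p=s_{j_1}\cdots s_{j_{p-1}}(\alpha_{j_p})$ for $1\le p\le l$; let $1\le r\le p\le l$, $w\in W$, $\nu\in\nu_R$. (i) The $\mathrm{ord}_w^\nu$ of any product in the expansion of $\kappa^\delta(\ddot G^+_{\alpha^p}\cdots\ddot G^+_{\alpha^r})$ is bounded below by $\mathrm{ord}_w^\nu(\kappa^\delta(f_{\alpha^p}\cdots f_{\alpha^r}))$. (ii) The $\mathrm{ord}_w^\nu$ of any product in the expansion of $\kappa^\delta(\ddot G^+_{-\alpha^r}\cdots\ddot G^+_{-\alpha^p})$ is bounded below by $\mathrm{ord}_w^\nu(\kappa^\delta(f_{-\alpha^r}\cdots f_{-\alpha^p}))$. (iii) The ${}^\dagger\mathrm{ord}_w^\nu$ of any product in the expansion of $\kappa^\delta(\ddot G^-_{\alpha^p}\cdots\ddot G^-_{\alpha^r})$ is bounded below by $\mathrm{ord}_w^\nu(\kappa^\delta(f_{\alpha^p}\cdots f_{\alpha^r}))$. (iv) The ${}^\dagger\mathrm{ord}_w^\nu$ of any product in the expansion of $\kappa^\delta(\ddot G^-_{-\alpha^r}\cdots\ddot G^-_{-\alpha^p})$ is bounded below by $\mathrm{ord}_w^\nu(\kappa^\delta(f_{-\alpha^r}\cdots f_{-\alpha^p}))$. B. Let $b=\pi_rs_{j_l}\cdots s_{j_1}$ be a reduced decomposition of $b\in P_+$ in $\hat W$, $\tilde\alpha^p=s_{j_1}\cdots s_{j_{p-1}}(\alpha_{j_p})$,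 and let $1\le p\le l$, $w\in W$, $\nu\in\nu_R$. (i) The $\mathrm{ord}_w^\nu$ of any product in the expansion of $\kappa^\delta(\ddot G^+_{\tilde\alpha^p}\cdots\ddot G^+_{\tilde\alpha^1})$ is bounded below by $\mathrm{ord}_w^\nu(\kappa^\delta(f_{\tilde\alpha^p}\cdots f_{\tilde\alpha^1}))$. (ii) The ${}^\dagger\mathrm{ord}_w^\nu$ of any product in the expansion of $\kappa^\delta(\ddot G^-_{-\tilde\alpha^1}\cdots\ddot G^-_{-\tilde\alpha^p})$ is bounded below by $\mathrm{ord}_w^\nu(\kappa^\delta(f_{-\tilde\alpha^1}\cdots f_{-\tilde\alpha^p}))$.
   Context: **Root data.** $R\subset\mathbb R^n$ is an irreducible reduced root system with simple roots $\alpha_1,\dots,\alpha_n$, positive roots $R_+$, Weyl group $W$, simple reflections $s_i$; the form is normalized by $(\alpha,\alpha)=2$ for short roots (all roots are short in the simply-laced case). $\nu_\alpha=(\alpha,\alpha)/2$, $\nu_R=\{\nu_\alpha\}$, $\alpha^\vee=2\alpha/(\alpha,\alpha)$; $P$ is the weight lattice, $P_+$ the dominant weights; $\rho_\nu^\vee=\frac1{2\nu}\sum_{\alpha\in R_+,\nu_\alpha=\nu}\alpha$. $\vartheta$ is the maximal short root. Affine roots $\tilde\alpha=[\alpha,\nu_\alpha j]\in\mathbb R^n\times\mathbb R$ ($\alpha\in R$, $j\in\mathbb Z$), $\alpha_0=[-\vartheta,1]$, $s_{\tilde\alpha}([z,\zeta])=[z,\zeta]-(z,\alpha^\vee)\tilde\alpha$,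 $b\in P$ acts by $b([z,\zeta])=[z,\zeta-(z,b)]$. $\hat W=W\ltimes P=\Pi\ltimes\langle s_0,\dots,s_n\rangle$, $\Pi=\{\pi_r\}$ the stabilizer of $\{\alpha_0,\dots,\alpha_n\}$; reduced decompositions are taken in $\langle s_0,\dots,s_n\rangle$ with $l(\pi_r\tilde w)=l(\tilde w)$. **Operators.** Let $q$ and $t_\nu$ ($\nu\in\nu_R$) be independent parameters, $t_\alpha=t_{\nu_\alpha}$, and write $q^{(\rho_k,b)}:=\prod_\nu t_\nu^{(\rho_\nu^\vee,b)}$. Difference-reflection operators are finite sums of $g\,\Gamma_a\,v$ with $g$ a rational function of the $X_b$ ($b\in P$, $X_bX_c=X_{b+c}$) over the field of rational functions of fractional powers of $q$ and of $t_\nu^{1/2}$, $a\in P$, $v\in W$; $\Gamma_bX_a=q^{(a,b)}X_a\Gamma_b$, $vX_a=X_{v(a)}v$, $v\Gamma_b=\Gamma_{v(b)}v$. An element $b\in P\subset\hat W$ is identified with $\Gamma_{-b}$, so $s_{[\alpha,\nu_\alpha j]}=\Gamma_{j\alpha}s_\alpha$; $X_{[\alpha,\nu_\alpha j]}=q^{\nu_\alpha j}X_\alpha$. For an affine root $\tilde\alpha=[\alpha,\nu_\alpha j]$: $$f_{\tilde\alpha}=\frac{t_\alpha X_{\tilde\alpha}^{-1}-1}{X_{\tilde\alpha}^{-1}-1},\quad g_{\tilde\alpha}=\frac{t_\alpha-1}{1-X_{\tilde\alpha}^{-1}},\quad \ddot G^+_{\tilde\alpha}=f_{\tilde\alpha}+g_{\tilde\alpha}s_{\tilde\alpha},\quad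 \ddot G^-_{\tilde\alpha}=f_{\tilde\alpha}-s_{\tilde\alpha}g_{\tilde\alpha}.$$ The *expansion* of a product of $\ddot G^\pm$'s is the sum of the products obtained by choosing from each factor $\ddot G^+_{\tilde\alpha}$ either $f_{\tilde\alpha}$ or $g_{\tilde\alpha}s_{\tilde\alpha}$, and from each $\ddot G^-_{\tilde\alpha}$ either $f_{\tilde\alpha}$ or $-s_{\tilde\alpha}g_{\tilde\alpha}$. **The map $\kappa^\delta$ and orders.** Let $\zeta_w$ ($w\in W$) be the orthogonal idempotents (characteristic functions of points) in functions on $W$, and let $v\in W$ act by $\delta(v)\zeta_w=\zeta_{vw}$. $\kappa^\delta$ is the algebra homomorphism from difference-reflection operators to operators on $W$-spinors (functions on $W$ with values in functions of $X$) with $\kappa^\delta(X_b)=\sum_wq^{-(\rho_k,w^{-1}(b))}X_{w^{-1}(b)}\zeta_w$, $\kappa^\delta(\Gamma_b)=\sum_wq^{-(\rho_k,w^{-1}(b))}\Gamma_{w^{-1}(b)}\zeta_w$, $\kappa^\delta(v)=\delta(v)$. For an operator $g\Gamma_a$, $\mathrm{ord}_w^\nu(\kappa^\delta(g\Gamma_a))$ is the order in $t_\nu$ (order of zero, or minus order of pole, at $t_\nu=0$) of the coefficient of $\Gamma_{w^{-1}(a)}\zeta_w$ in $\kappa^\delta(g\Gamma_a)$. For $v\in W$: $\mathrm{ord}_w^\nu(\kappa^\delta(g\Gamma_av)):=\mathrm{ord}_w^\nu(\kappa^\delta(g\Gamma_a))$ (all elements of $W$ moved to the right) and ${}^\dagger\mathrm{ord}_w^\nu(\kappa^\delta(v\,g\Gamma_a)):=\mathrm{ord}_w^\nu(\kappa^\delta(g\Gamma_a))$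 (all elements of $W$ moved to the left). *)

(* Defs.v *)
From HB Require Import structures.
From mathcomp Require Import all_boot all_order all_algebra.
From mathcomp Require Import fraction.
From mathcomp Require Import finmap reals constructive_ereal.
(* Notation levels of multinomials clash with those loaded by reals. The names
   common to monalg and mpoly are used qualified. *)
From mathcomp Require Import -(notations) monalg mpoly.

Set Implicit Arguments.
Unset Strict Implicit.
Unset Printing Implicit Defensive.
Import Order.TTheory GRing.Theory Num.Theory.
Local Open Scope ring_scope.

(* Vectors are columns, so that linear maps act on the left. *)

Section Form.
Context {R : realType} {n : nat}.
Implicit Types (G : 'M[R]_n) (x y a : 'cV[R]_n).

Definition euclid G x y : R := (x^T *m G *m y) 0 0.

Definition crt G a : 'cV[R]_n := (2 / euclid G a a) *: a.

(* matrix of x |-> x - (x, a^vee) a *)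
Definition refl G a : 'M[R]_n := 1%:M - a *m (crt G a)^T *m G.

Definition nonneg_comb (simple : 'I_n -> 'cV[R]_n) x : Prop :=
  exists c : 'I_n -> nat, x = \sum_i (c i)%:R *: simple i.

End Form.

Record rootData (R : realType) (n : nat) := RootData {
  gram : 'M[R]_n;
  gram_sym : gram^T = gram;
  gram_pos : forall x : 'cV[R]_n, x != 0 -> 0 < euclid gram x x;
  roots : {fset 'cV[R]_n};
  roots_neq0 : 0 \notin roots;
  roots_span : forall x : 'cV[R]_n,
    exists c : 'cV[R]_n -> R, x = \sum_(a <- roots) c a *: a;
  roots_refl : forall a b, a \in roots -> b \in roots ->
    refl gram a *m b \in roots;
  roots_int : forall a b, a \in roots -> b \in roots ->
    euclid gram b (crt gram a) \is a Num.int;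
  roots_reduced : forall a (c : R), a \in roots -> c *: a \in roots ->
    c = 1 \/ c = -1;
  roots_nonempty : roots != fset0;
  roots_irreducible : forall S : pred 'cV[R]_n,
    (forall a b, a \in roots -> b \in roots -> S a -> ~~ S b ->
       euclid gram a b = 0) ->
    (forall a, a \in roots -> S a) \/ (forall a, a \in roots -> ~~ S a);
  simple : 'I_n -> 'cV[R]_n;
  simple_root : forall i, simple i \in roots;
  simple_free : forall c : 'I_n -> R,
    \sum_i c i *: simple i = 0 -> forall i, c i = 0;
  simple_base : forall a, a \in roots ->
    nonneg_comb simple a \/ nonneg_comb simple (- a);
  (* short roots have square length 2 *)
  form_short : exists2 a, a \in roots & euclid gram a a = 2;
  form_ge2 : forall a, a \in roots -> 2 <= euclid gram a a;
  theta : 'cV[R]_n;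
  theta_root : theta \in roots;
  theta_short : euclid gram theta theta = 2;
  theta_max : forall a, a \in roots -> euclid gram a a = 2 ->
    nonneg_comb simple (theta - a)
}.

Section Roots.
Context {R : realType} {n : nat} (D : rootData R n).
Implicit Types (x y a b : 'cV[R]_n) (v w : 'M[R]_n).

Local Notation "(| x , y |)" := (euclid (gram D) x y).

Definition coroot a := crt (gram D) a.
Definition nu a : R := (|a, a|) / 2.
Definition nuR : seq R := undup [seq nu a | a <- roots D].

Definition simple_mx : 'M[R]_n := \matrix_(i, j) simple D j i 0.
Definition pos_root a : bool :=
  (a \in roots D) && [forall i, 0 <= (invmx simple_mx *m a) i 0].

(* rho_nu^vee *)
Definition rhov (z : R) : 'cV[R]_n :=
  (2 * z)^-1 *: \sum_(a <- roots D | pos_root a && (nu a == z)) a.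

(* the dual basis of the simple coroots *)
Definition coroot_mx : 'M[R]_n := \matrix_(i, j) coroot (simple D j) i 0.
Definition fund_weight (i : 'I_n) : 'cV[R]_n :=
  (row i (invmx (gram D *m coroot_mx)))^T.

Definition in_P b : Prop :=
  forall i, (|b, coroot (simple D i)|) \is a Num.int.
Definition in_Pplus b : Prop :=
  in_P b /\ forall i, 0 <= (|b, coroot (simple D i)|).

(* word [:: i_1; ...; i_l] is s_(i_1) ... s_(i_l) *)
Definition word (js : seq 'I_n) : 'M[R]_n :=
  foldr (fun j M => refl (gram D) (simple D j) *m M) 1%:M js.
Definition in_W w : Prop := exists js, w = word js.
Definition reduced (js : seq 'I_n) : Prop :=
  forall js', word js' = word js -> (size js <= size js')%N.

(* The pair (a, z) is [a, z]; it is an affine root for a \in R and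
   z = nu_a j, j integral. The group hat W = W |x P is identified with its
   (faithful) action on R^n x R. *)
Definition aff := ('cV[R]_n * R)%type.

Definition aff_opp (A : aff) : aff := (- A.1, - A.2).
Definition aff_refl (A : aff) (Z : aff) : aff :=
  let c := (|Z.1, coroot A.1|) in (Z.1 - c *: A.1, Z.2 - c * A.2).
Definition transl b (Z : aff) : aff := (Z.1, Z.2 - (|Z.1, b|)).
Definition lin_aff w (Z : aff) : aff := (w *m Z.1, Z.2).

(* index 0 is alpha_0, index i.+1 is alpha_i of the finite system *)
Definition aff_simple (j : 'I_n.+1) : aff :=
  if unlift ord0 j is Some i then (simple D i, 0) else (- theta D, 1).

Definition aff_word (js : seq 'I_n.+1) : aff -> aff :=
  foldr (fun j f => aff_refl (aff_simple j) \o f) id js.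
Definition aff_reduced (js : seq 'I_n.+1) : Prop :=
  forall js', aff_word js' =1 aff_word js -> (size js <= size js')%N.

Definition in_hatW (h : aff -> aff) : Prop :=
  exists w b, [/\ in_W w, in_P b & h =1 lin_aff w \o transl b].
(* h is injective and the simple affine roots are finitely many, so mapping
   their set into itself is stabilizing it *)
Definition in_Pi (h : aff -> aff) : Prop :=
  in_hatW h /\ forall i, exists j, h (aff_simple i) = aff_simple j.

(* For js = [:: j_1; ...; j_l], the sequence of the roots
   s_(j_1) ... s_(j_(p-1)) (alpha_(j_p)), 1 <= p <= l. *)
Definition root_seq (js : seq 'I_n) : seq aff :=
  [seq (word (take ij.1 js) *m simple D ij.2, 0)
     | ij <- zip (iota 0 (size js)) js].
Definition aff_root_seq (js : seq 'I_n.+1) : seq aff :=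
  [seq aff_word (take ij.1 js) (aff_simple ij.2)
     | ij <- zip (iota 0 (size js)) js].

End Roots.

(* elements number r, ..., p of s, counted from 1 *)
Definition slice (T : Type) (r p : nat) (s : seq T) : seq T :=
  drop r.-1 (take p s).


Section Operators.
Context {R : realType} {n : nat} (D : rootData R n).
(* constants; fractional powers of q have exponents in (1/m) Z *)
Context (k : fieldType) (m : nat).
Implicit Types (x y a b : 'cV[R]_n) (v w : 'M[R]_n) (A : aff (R := R) (n := n)).

Local Notation "(| x , y |)" := (euclid (gram D) x y).

(* The variables: q^(1/m), the t_nu^(1/2) for nu in nu_R, and
   X_i = X_(omega_i), 1 <= i <= n. *)
Definition ncoef := (size (nuR D)).+1.
Definition nvar := (ncoef + n)%N.
Definition q_idx : 'I_nvar := lshift n ord0.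
Definition t_idx (z : R) : 'I_nvar :=
  lshift n (inord (index z (nuR D)).+1 : 'I_ncoef).

Local Notation Pol := (mpoly nvar k).
Local Notation F := {fraction Pol}.

Definition var (i : 'I_nvar) : F := tofrac (mpolyX k (mnm1 i)).

(* q^r, for r in (1/m) Z *)
Definition qpow (r : R) : F := var q_idx ^ Num.floor (m%:R * r).
(* t_z^r, for r in (1/2) Z *)
Definition tpow (z r : R) : F := var (t_idx z) ^ Num.floor (2 * r).
(* q^(rho_k, x) *)
Definition q_rho x : F := \prod_(z <- nuR D) tpow z (|rhov D z, x|).

(* X_b, for b in P *)
Definition Xmon b : F :=
  \prod_(i < n)
    var (rshift ncoef i) ^ Num.floor (|b, coroot D (simple D i)|).

(* X_[a, z] = q^z X_a *)
Definition Xaff A : F := qpow A.2 * Xmon A.1.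

(* Replaces every X_i by h i, fixing q and the t_nu. Used only for
   substitutions of every X_i by X_(b_i) times a monomial in q and the t_nu,
   for bases b_i of P; these are automorphisms of F. *)
Definition subst (h : 'I_n -> F) (f : F) : F :=
  let ev := mpoly.mmap (fun c : k => tofrac (mpolyC nvar c))
    (fun j : 'I_nvar => if split j is inr i then h i else var j) in
  ev (frac (repr f)).1 / ev (frac (repr f)).2.

(* Gamma_b X_a Gamma_b^-1 = q^(a, b) X_a,  v X_a v^-1 = X_(v(a)) *)
Definition Gam_act b : F -> F :=
  subst (fun i => qpow (|fund_weight D i, b|) * Xmon (fund_weight D i)).
Definition W_act v : F -> F := subst (fun i => Xmon (v *m fund_weight D i)).

(* Finite formal sums of the g Gamma_a v; the coefficient at (a, v) is g. *)
Definition dro : zmodType := monalg.malg ('cV[R]_n * 'M[R]_n)%type F.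

Definition dr_term (g : F) a v : dro := monalg.mkmalgU (a, v) g.

(* (g Gamma_a v) (g' Gamma_a' v') =
     g Gamma_a(v(g')) Gamma_(a + v(a')) v v' *)
Definition dr_mul (U T : dro) : dro :=
  \sum_(s <- monalg.msupp U) \sum_(t <- monalg.msupp T)
    dr_term (monalg.mcoeff s U * Gam_act s.1 (W_act s.2 (monalg.mcoeff t T)))
      (s.1 + s.2 *m t.1) (s.2 *m t.2).

Definition dr_fun (g : F) : dro := dr_term g 0 1%:M.
Definition dr_Gam a : dro := dr_term 1 a 1%:M.
Definition dr_W v : dro := dr_term 1 0 v.

(* Finite formal sums of the h Gamma_c zeta_w delta(v): the coefficient of
   h Gamma_c zeta_w delta(v) in U is the coefficient of U w at (c, v). The
   functions of X and the Gamma_c commute with the zeta_w and delta(v). *)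
Definition spo := 'M[R]_n -> dro.

(* zeta_w delta(v) zeta_w' delta(v') = zeta_w delta(v v') if w = v w',
   and 0 otherwise *)
Definition sp_mul (U T : spo) : spo := fun w =>
  \sum_(s <- monalg.msupp (U w))
    \sum_(t <- monalg.msupp (T (invmx s.2 *m w)))
      dr_term
        (monalg.mcoeff s (U w) *
           Gam_act s.1 (monalg.mcoeff t (T (invmx s.2 *m w))))
        (s.1 + t.1) (s.2 *m t.2).

Definition sp_coef (U : spo) w (c : 'cV[R]_n) v : F :=
  monalg.mcoeff (c, v) (U w).

(* sum_w g(X_b := q^(-(rho_k, w^-1(b))) X_(w^-1(b))) zeta_w *)
Definition kappa_fun (g : F) : spo := fun w =>
  dr_fun (subst (fun i =>
    let c := invmx w *m fund_weight D i in (q_rho c)^-1 * Xmon c) g).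
(* sum_w q^(-(rho_k, w^-1(a))) Gamma_(w^-1(a)) zeta_w *)
Definition kappa_Gam a : spo := fun w =>
  dr_term (q_rho (invmx w *m a))^-1 (invmx w *m a) 1%:M.
(* delta(v) = sum_w zeta_w delta(v) *)
Definition kappa_W v : spo := fun w => dr_W v.

(* kappa^delta, from its values on the generators *)
Definition kappa (U : dro) : spo := fun w =>
  \sum_(s <- monalg.msupp U)
    sp_mul (sp_mul (kappa_fun (monalg.mcoeff s U)) (kappa_Gam s.1))
      (kappa_W s.2) w.

(* smallest exponent of the i-th variable in p; the neutral element msize p
   exceeds all exponents and is not reached if p != 0 *)
Definition poly_ord (i : 'I_nvar) (p : Pol) : nat :=
  \big[minn/mpoly.msize p]_(e <- mpoly.msupp p) (e i).

(* order in t_z at t_z = 0; the order of the variable t_z^(1/2) is 1/2 *)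
Definition ord_t (z : R) (f : F) : \bar rat :=
  if f == 0 then +oo%E else
  (((poly_ord (t_idx z) (frac (repr f)).1)%:R -
    (poly_ord (t_idx z) (frac (repr f)).2)%:R) / 2)%:E.

(* ord_w^nu (kappa^delta (g Gamma_a)) *)
Definition ord_kappa w (z : R) (g : F) a : \bar rat :=
  ord_t z (sp_coef (kappa (dr_term g a 1%:M)) w (invmx w *m a) 1%:M).

(* U has the form g Gamma_a v, and o is ord_w^nu (kappa^delta U) *)
Definition is_ord w (z : R) (U : dro) (o : \bar rat) : Prop :=
  exists g a v, [/\ in_P D a, in_W D v,
    U = dr_mul (dr_mul (dr_fun g) (dr_Gam a)) (dr_W v) &
    o = ord_kappa w z g a].

(* U has the form v g Gamma_a, and o is ^dagger ord_w^nu (kappa^delta U) *)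
Definition is_dag_ord w (z : R) (U : dro) (o : \bar rat) : Prop :=
  exists g a v, [/\ in_P D a, in_W D v,
    U = dr_mul (dr_W v) (dr_mul (dr_fun g) (dr_Gam a)) &
    o = ord_kappa w z g a].

Definition t_root A : F := tpow (nu D A.1) 1.

Definition f_aff A : F := (t_root A * (Xaff A)^-1 - 1) / ((Xaff A)^-1 - 1).
Definition g_aff A : F := (t_root A - 1) / (1 - (Xaff A)^-1).

(* s_[a, nu_a j] = Gamma_(j a) s_a *)
Definition s_aff A : dro :=
  dr_mul (dr_Gam ((A.2 / nu D A.1) *: A.1)) (dr_W (refl (gram D) A.1)).

(* G^+_A and G^-_A, as pairs of their two summands *)
Definition Gplus A : dro * dro :=
  (dr_fun (f_aff A), dr_mul (dr_fun (g_aff A)) (s_aff A)).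
Definition Gminus A : dro * dro :=
  (dr_fun (f_aff A), - dr_mul (s_aff A) (dr_fun (g_aff A))).

Fixpoint expansion (Gs : seq (dro * dro)) : seq dro :=
  if Gs is G :: Gs' then
    [seq dr_mul U T | U <- [:: G.1; G.2], T <- expansion Gs']
  else [:: dr_fun 1].

(* ord_w^nu (kappa^delta (product of the f_A, A in As)) *)
Definition ord_f w (z : R) (As : seq (aff (R := R) (n := n))) : \bar rat :=
  ord_kappa w z (\prod_(A <- As) f_aff A) 0.

Definition ord_bounded w (z : R) (As : seq (aff (R := R) (n := n))) : Prop :=
  forall U, U \in expansion [seq Gplus A | A <- As] ->
    exists2 o, is_ord w z U o & (ord_f w z As <= o)%E.

Definition dag_ord_bounded w (z : R) (As : seq (aff (R := R) (n := n)))
    : Prop :=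
  forall U, U \in expansion [seq Gminus A | A <- As] ->
    exists2 o, is_dag_ord w z U o & (ord_f w z As <= o)%E.

End Operators.

(* Main.v *)
From HB Require Import structures.
From mathcomp Require Import all_boot all_order all_algebra.
From mathcomp Require Import fraction generic_quotient.
From mathcomp Require Import finmap reals constructive_ereal.
From mathcomp Require Import ring lra zify.
From mathcomp Require Import -(notations) monalg mpoly.
Require Import Defs.

(** Fix z in nu_R, write v for the inverse of w, and measure orders in t_z^(1/2).
    Let H(x) = [height2 D z x] be the sum of the pairings (x, a^vee) over the
    positive roots a with nu_a = z, so that q^(rho_k, x) has order H(x). All
    coefficients in question are products of fractions of the form
    (monomial - 1) / (monomial - 1), whose orders are explicit
    ([kappa_factor]): at a root a, the factor f has order 2 if nu_a = z and v a
    is negative, and order 0 otherwise; the factor g has order max (0, - H(v a));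
    Gamma_b has order - H(v b).

    Moving the chosen reflections to the right turns a product in the expansion
    into a product of factors at roots changed by the reflections chosen before,
    and the reflection at [a, nu_a j] adds the translation by j a. Hence the order
    of the product is a sum ([total]) in which a chosen reflection replaces v by
    v s_a for all later factors. Moving them to the left gives the same sum for
    the reversed sequence and with the opposite sign of the translations. By
    [ars_rev] and by allowing - v in place of v, all six sequences of roots take
    one shape: the roots of a word, the last one first ([finite_costs],
    [dominant_costs]). The bound then follows by induction on the word
    ([total_ge]) from the effect of a single reflection ([key_ineq]): for the last
    root [a, nu_a j] of a word and the set N of the other ones,

      2 [nu_a = z, v a < 0] + 2 #{b in N : nu_b = z, v b < 0}
        <= max (0, - H(v a)) - j H(v a) + 2 #{b in N : nu_b = z, v s_a b < 0}.

    To see this, count each root b with the multiplicity with which it occurs in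
    N as a first component, minus that of - b. This signed count has a closed form
    for every word ([signed_count_ars]), additive in the coroot of b up to the
    signs of b and of its image, and its difference at b and s_a b is j (a, b^vee)
    plus a sign change. Summed against the sign changes that s_a causes after
    applying v, the multiple of j gives j H(v a), because H(v a) is itself such
    a sum ([height2_turn]); the rest is an inequality between terms of the same
    sign. This needs that a is positive. For a reduced word in W it is the exchange
    condition ([exchange_free_pos]); for a dominant translation b, the affine roots
    that b makes negative have a positive first component
    ([dominant_word_pos]).

    On the side of the operators one needs that the substitutions of monomials are
    field morphisms, which holds because their matrices of exponents are
    invertible ([ev_mx_inj]), and that orders are additive and do not depend on
    representatives of fractions ([mpordM], [num_den_cross]). *)

Set Implicit Arguments.
Unset Strict Implicit.
Unset Printing Implicit Defensive.
Import Order.TTheory GRing.Theory Num.Theory.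
Local Open Scope ring_scope.

(** * Invariant forms and reflections *)

Section Form.
Context {R : realType} {n : nat} (G : 'M[R]_n).
Implicit Types x y : 'cV[R]_n.

Lemma euclidDl x y t : euclid G (x + y) t = euclid G x t + euclid G y t.
Proof. by rewrite /euclid linearD /= !mulmxDl mxE. Qed.

Lemma euclidDr x y t : euclid G t (x + y) = euclid G t x + euclid G t y.
Proof. by rewrite /euclid mulmxDr mxE. Qed.

Lemma euclidZl c x y : euclid G (c *: x) y = c * euclid G x y.
Proof. by rewrite /euclid linearZ /= -!scalemxAl mxE. Qed.

Lemma euclidZr c x y : euclid G x (c *: y) = c * euclid G x y.
Proof. by rewrite /euclid -scalemxAr mxE. Qed.

Lemma euclidNl x y : euclid G (- x) y = - euclid G x y.
Proof. by rewrite -scaleN1r euclidZl mulN1r. Qed.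

Lemma euclidNr x y : euclid G x (- y) = - euclid G x y.
Proof. by rewrite -scaleN1r euclidZr mulN1r. Qed.

Lemma euclidBl x y t : euclid G (x - y) t = euclid G x t - euclid G y t.
Proof. by rewrite euclidDl euclidNl. Qed.

Lemma euclidBr x y t : euclid G t (x - y) = euclid G t x - euclid G t y.
Proof. by rewrite euclidDr euclidNr. Qed.

Lemma euclid0l x : euclid G 0 x = 0.
Proof. by rewrite -(scale0r 0) euclidZl mul0r. Qed.

Lemma euclid_suml I (r : seq I) P (F : I -> 'cV[R]_n) y :
  euclid G (\sum_(i <- r | P i) F i) y = \sum_(i <- r | P i) euclid G (F i) y.
Proof.
elim/big_rec2: _ => [|i a b _ <-]; first exact: euclid0l.
by rewrite euclidDl.
Qed.

Lemma euclid_sumr I (r : seq I) P (F : I -> 'cV[R]_n) y :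
  euclid G y (\sum_(i <- r | P i) F i) = \sum_(i <- r | P i) euclid G y (F i).
Proof.
elim/big_rec2: _ => [|i a b _ <-]; last by rewrite euclidDr.
by rewrite -(scale0r 0) euclidZr mul0r.
Qed.

Lemma reflE a x : refl G a *m x = x - euclid G (crt G a) x *: a.
Proof.
rewrite /refl mulmxBl mul1mx -!mulmxA [X in a *m X]mx11_scalar mul_mx_scalar.
by rewrite /euclid mulmxA.
Qed.

End Form.

(** * Roots and coroots *)

Section RootSystem.
Context {R : realType} {n : nat} (D : rootData R n).
Implicit Types (a b x y : 'cV[R]_n) (v : 'M[R]_n).

Local Notation "(| x , y |)" := (euclid (gram D) x y).
Local Notation rt := (roots D).
Local Notation sr a := (refl (gram D) a).
Local Notation pos := (pos_root D).
Local Notation "a ^v" := (coroot D a) (at level 2, format "a ^v").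

Lemma euclidC x y : (|x, y|) = (|y, x|).
Proof.
rewrite /euclid -[in RHS](gram_sym D).
suff -> : y^T *m (gram D)^T *m x = (x^T *m gram D *m y)^T by rewrite [RHS]mxE.
by rewrite !trmx_mul trmxK mulmxA.
Qed.

Lemma root_neq0 a : a \in rt -> a != 0.
Proof. by apply: contraTneq => ->; exact: roots_neq0. Qed.

Lemma norm_gt0 a : a \in rt -> 0 < (|a, a|).
Proof. by move=> /root_neq0; exact: gram_pos. Qed.

Lemma nu_gt0 a : a \in rt -> 0 < nu D a.
Proof. by move=> ra; rewrite /nu divr_gt0 ?norm_gt0. Qed.

Lemma nu_neq0 a : a \in rt -> nu D a != 0.
Proof. by move=> ra; rewrite gt_eqF ?nu_gt0. Qed.

Lemma corootE a : a^v = (nu D a)^-1 *: a.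
Proof. by rewrite /coroot /crt /nu invf_div. Qed.

Lemma coroot_self a : a \in rt -> (|a, a^v|) = 2.
Proof.
by move=> ra; rewrite /coroot /crt euclidZr mulfVK // gt_eqF // norm_gt0.
Qed.

Lemma srE a x : sr a *m x = x - (|x, a^v|) *: a.
Proof. by rewrite reflE euclidC. Qed.

Lemma sr_self a : a \in rt -> sr a *m a = - a.
Proof. by move=> ra; rewrite srE coroot_self // scaler_nat mulr2n opprD addNKr. Qed.

Lemma rootN a : (- a \in rt) = (a \in rt).
Proof.
suff N b : b \in rt -> - b \in rt.
  by apply/idP/idP => /N //; rewrite opprK.
by move=> rb; rewrite -(sr_self rb) roots_refl.
Qed.

Lemma nuN a : nu D (- a) = nu D a.
Proof. by rewrite /nu euclidNl euclidNr opprK. Qed.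

Lemma corootN a : (- a)^v = - a^v.
Proof. by rewrite !corootE nuN scalerN. Qed.

Lemma srN a : sr (- a) = sr a.
Proof.
apply/matrixP => i j; have := srE (- a) (delta_mx j 0).
rewrite corootN euclidNr scalerN scaleNr opprK -srE => /matrixP /(_ i 0).
by rewrite -!colE !mxE.
Qed.

Lemma srK a x : a \in rt -> sr a *m (sr a *m x) = x.
Proof.
move=> ra; rewrite (srE a x) mulmxBr -scalemxAr sr_self // srE scalerN opprK.
by rewrite subrK.
Qed.

Lemma sr_sq a : a \in rt -> sr a *m sr a = 1%:M.
Proof.
move=> ra; apply/matrixP => i j.
have /matrixP /(_ i 0) := srK (delta_mx j 0) ra.
by rewrite mulmxA -[LHS]/(_ i 0) -colE !mxE eqxx andbT => ->.
Qed.


(** Besides the Weyl group, [- 1] is needed: it exchanges the two kinds of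
    expansions. *)
Definition isom v := (forall x y, (|v *m x, v *m y|) = (|x, y|)) /\
  (forall a, a \in rt -> v *m a \in rt).

Lemma isom1 : isom 1%:M.
Proof. by split=> *; rewrite !mul1mx. Qed.

Lemma isomM v v' : isom v -> isom v' -> isom (v *m v').
Proof.
move=> [e r] [e' r']; split=> [x y|a ra]; first by rewrite -!mulmxA e e'.
by rewrite -mulmxA r // r'.
Qed.

Lemma isomN v : isom v -> isom (- v).
Proof.
move=> [e r]; split=> [x y|a ra].
  by rewrite !mulNmx euclidNl euclidNr opprK e.
by rewrite mulNmx rootN r.
Qed.

Lemma isom_sr a : a \in rt -> isom (sr a).
Proof.
move=> ra; split=> [x y|b rb]; last exact: roots_refl.
have a0 := norm_gt0 ra.
rewrite !srE !(euclidBl, euclidBr, euclidZl, euclidZr).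
by rewrite (euclidC a y) /nu; field; rewrite gt_eqF.
Qed.

Lemma isom_nu v a : isom v -> nu D (v *m a) = nu D a.
Proof. by case=> e _; rewrite /nu e. Qed.

Lemma isom_coroot v a : isom v -> (v *m a)^v = v *m a^v.
Proof. by move=> vi; rewrite !corootE isom_nu // scalemxAr. Qed.

Lemma isom_refl v a x : isom v -> sr (v *m a) *m (v *m x) = v *m (sr a *m x).
Proof.
move=> vi; rewrite !srE isom_coroot //; case: (vi) => -> _.
by rewrite mulmxBr scalemxAr.
Qed.

Lemma gram_unit : gram D \in unitmx.
Proof.
rewrite -row_free_unit; apply: inj_row_free => v v0; apply/eqP.
apply/negPn/negP => vN0; have := gram_pos D (x := v^T).
by rewrite trmx_eq0 vN0 /euclid trmxK v0 mul0mx mxE ltxx => /(_ isT).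
Qed.

Lemma isom_inj v : isom v -> injective (mulmx v : 'cV[R]_n -> 'cV[R]_n).
Proof.
move=> [e _] x y vxy; apply/eqP; rewrite -subr_eq0; apply/negPn/negP => /(gram_pos D).
by rewrite -e mulmxBr vxy subrr euclid0l ltxx.
Qed.

Lemma isom_unit v : isom v -> v \in unitmx.
Proof.
move=> vi; rewrite -unitmx_tr -row_free_unit; apply: inj_row_free => u u0.
apply: trmx_inj; rewrite trmx0; apply: (isom_inj vi); rewrite mulmx0.
by rewrite -[v]trmxK -trmx_mul u0 trmx0.
Qed.

Lemma perm_isom v : isom v -> perm_eq [seq v *m a | a <- rt] rt.
Proof.
move=> vi; have u : uniq [seq v *m a | a <- rt].
  by rewrite map_inj_uniq ?fset_uniq //; exact: isom_inj.
apply: (uniq_perm u (fset_uniq _)).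
have /(uniq_min_size u) : {subset [seq v *m a | a <- rt] <= rt}.
  by move=> _ /mapP[a ra ->]; exact: vi.2.
by rewrite size_map leqnn => /(_ isT) [].
Qed.

Lemma sum_isom v (P : pred 'cV[R]_n) (F : 'cV[R]_n -> R) : isom v ->
  \sum_(a <- rt | P a) F a = \sum_(a <- rt | P (v *m a)) F (v *m a).
Proof. by move=> vi; rewrite -(perm_big _ (perm_isom vi)) /= big_map. Qed.

Lemma isom_opp1 : isom (- 1%:M). Proof. exact/isomN/isom1. Qed.

Lemma sum_rootN (P : pred 'cV[R]_n) (F : 'cV[R]_n -> R) :
  \sum_(a <- rt | P a) F a = \sum_(a <- rt | P (- a)) F (- a).
Proof.
rewrite (sum_isom P F isom_opp1).
by apply: eq_big => [a|a _]; rewrite mulNmx mul1mx.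
Qed.

(** * Positive roots *)

Definition coord x i : R := (invmx (simple_mx D) *m x) i 0.

Lemma simple_mxE (c : 'cV[R]_n) : simple_mx D *m c = \sum_i c i 0 *: simple D i.
Proof.
apply/colP => i; rewrite mxE summxE; apply: eq_bigr => j _.
by rewrite !mxE mulrC.
Qed.

Lemma simple_mx_unit : simple_mx D \in unitmx.
Proof.
rewrite -unitmx_tr -row_free_unit; apply: inj_row_free => u u0.
apply/rowP => i; rewrite mxE; have := @simple_free _ _ D (fun j => u 0 j).
apply; apply: etrans (_ : simple_mx D *m u^T = 0).
  by rewrite simple_mxE; apply: eq_bigr => j _; rewrite mxE.
by apply: trmx_inj; rewrite trmx_mul trmxK u0 trmx0.
Qed.

Lemma coord_sum x : x = \sum_i coord x i *: simple D i.
Proof. by rewrite -simple_mxE mulKVmx ?simple_mx_unit. Qed.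

Lemma coordD x y i : coord (x + y) i = coord x i + coord y i.
Proof. by rewrite /coord mulmxDr mxE. Qed.

Lemma coordZ c x i : coord (c *: x) i = c * coord x i.
Proof. by rewrite /coord -scalemxAr mxE. Qed.

Lemma coordN x i : coord (- x) i = - coord x i.
Proof. by rewrite -scaleN1r coordZ mulN1r. Qed.

Lemma coordB x y i : coord (x - y) i = coord x i - coord y i.
Proof. by rewrite coordD coordN. Qed.

Lemma coord_simple i j : coord (simple D j) i = (i == j)%:R.
Proof.
rewrite /coord; have -> : simple D j = simple_mx D *m delta_mx j 0.
  rewrite simple_mxE (bigD1 j) //= mxE !eqxx scale1r big1 ?addr0 // => k kj.
  by rewrite mxE (negbTE kj) scale0r.
by rewrite mulKmx ?simple_mx_unit // mxE eqxx andbT.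
Qed.

Lemma coord_comb (c : 'I_n -> R) i : coord (\sum_j c j *: simple D j) i = c i.
Proof.
rewrite /coord mulmx_sumr summxE (bigD1 i) //= -[X in X + _]/(coord _ i).
rewrite coordZ coord_simple eqxx mulr1 big1 ?addr0 // => j ji.
by rewrite -[LHS]/(coord _ i) coordZ coord_simple eq_sym (negbTE ji) mulr0.
Qed.

Lemma nonneg_coord x i : nonneg_comb (simple D) x -> 0 <= coord x i.
Proof. by case=> c ->; rewrite coord_comb. Qed.

Lemma posE a : pos a = (a \in rt) && [forall i, 0 <= coord a i].
Proof. by []. Qed.

Lemma pos_mem a : pos a -> a \in rt.
Proof. by case/andP. Qed.

Lemma pos_coord a i : pos a -> 0 <= coord a i.
Proof. by case/andP=> _ /forallP /(_ i). Qed.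

Lemma coord_eq0 x : (forall i, coord x i = 0) -> x = 0.
Proof. by move=> x0; rewrite (coord_sum x) big1 // => i _; rewrite x0 scale0r. Qed.

Lemma posN a : a \in rt -> pos (- a) = ~~ pos a.
Proof.
move=> ra; have [pa|] := boolP (pos a).
  apply/negbTE/negP => pNa; have /eqP := root_neq0 ra; apply; apply: coord_eq0 => i.
  by apply/le_anti; rewrite (pos_coord i pa) -oppr_ge0 -coordN pos_coord.
rewrite !posE rootN ra /= => /negP npa; apply/forallP => i.
by case: (simple_base ra) => /nonneg_coord // a0; case: npa; apply/forallP.
Qed.

(** The coordinates of a root have the same sign, so one of them decides. *)
Lemma pos_of_coord a i : a \in rt -> 0 < coord a i -> pos a.
Proof.
move=> ra; apply: contraTT; rewrite -posN // => /(pos_coord i).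
by rewrite coordN oppr_ge0 leNgt.
Qed.

Lemma pos_simple i : pos (simple D i).
Proof.
apply: (@pos_of_coord _ i); first exact: simple_root.
by rewrite coord_simple eqxx.
Qed.

Lemma pos_addZ a b c : pos a -> pos b -> 0 <= c -> a + c *: b \in rt ->
  pos (a + c *: b).
Proof.
move=> pa pb c0 r; rewrite posE r; apply/forallP => i.
by rewrite coordD coordZ addr_ge0 ?mulr_ge0 ?pos_coord.
Qed.

(** A positive root other than [simple D i] has a positive coordinate at some
    other simple root, and the reflection keeps it. *)
Lemma pos_sr_simple i a : pos a -> a != simple D i -> pos (sr (simple D i) *m a).
Proof.
move=> pa ai; have ra := pos_mem pa; have ri := simple_root D i.
have [k ki ak] : exists2 k, k != i & 0 < coord a k.
  have [/existsP[k /andP[ki ak]]|] :=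
    boolP [exists k, (k != i) && (0 < coord a k)]; first by exists k.
  rewrite negb_exists => /forallP z; exfalso.
  have aE : a = coord a i *: simple D i.
    rewrite {1}(coord_sum a) (bigD1 i) //= big1 ?addr0 // => k ki.
    have /negP := z k; rewrite ki /= lt_neqAle pos_coord // andbT.
    by move=> /negP; rewrite negbK => /eqP <-; rewrite scale0r.
  have [|e|e] := @roots_reduced _ _ D _ (coord a i) ri; first by rewrite -aE.
    by rewrite aE e scale1r eqxx in ai.
  by move: pa; rewrite aE e scaleN1r posN // pos_simple.
apply: (@pos_of_coord _ k); first exact: roots_refl.
by rewrite srE coordB coordZ coord_simple (negbTE ki) mulr0 subr0.
Qed.

Definition neg a : R := (~~ pos a)%:R.

Lemma negN a : a \in rt -> neg (- a) = 1 - neg a.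
Proof. by move=> ra; rewrite /neg posN // negbK; case: (pos a); rewrite ?subr0 ?subrr. Qed.

(** As an equation between indicators, this records at once that the reflection
    permutes the positive roots other than [simple D i], and the same for the
    negative ones; such equations can be summed along a word. *)
Lemma neg_sr_simple i a : a \in rt ->
  neg (sr (simple D i) *m a) - neg a = (a == simple D i)%:R - (a == - simple D i)%:R.
Proof.
have ri := simple_root D i; have pi := pos_simple i.
have P b : pos b ->
  neg (sr (simple D i) *m b) - neg b = (b == simple D i)%:R - (b == - simple D i)%:R.
  move=> pb; have -> : (b == - simple D i) = false.
    by apply: contraTF pb => /eqP ->; rewrite posN // pi.
  have [->|bi] := eqVneq b (simple D i).
    by rewrite sr_self // /neg posN // pi /=; ring.
  by rewrite /neg pb pos_sr_simple.
move=> ra; have [/P//|npa] := boolP (pos a).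
have := P (- a); rewrite posN // npa => /(_ isT).
rewrite mulmxN !negN ?roots_refl // eqr_oppLR (eqr_oppLR a (- _)) opprK; lra.
Qed.


(** Otherwise the simple reflection would raise theta to a larger short root. *)
Lemma theta_dom_simple i : 0 <= (|theta D, (simple D i)^v|).
Proof.
have ri := simple_root D i; have rth := theta_root D.
rewrite leNgt; apply/negP => lt0.
have := @theta_max _ _ D (sr (simple D i) *m theta D).
rewrite roots_refl // (isom_sr ri).1 theta_short => /(_ isT erefl).
move=> /(nonneg_coord i); rewrite srE opprB addrC subrK coordZ coord_simple eqxx.
by rewrite mulr1 leNgt lt0.
Qed.

Lemma theta_dom a : pos a -> 0 <= (|theta D, a|).
Proof.
move=> pa; rewrite (coord_sum a) euclid_sumr sumr_ge0 // => i _.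
rewrite euclidZr mulr_ge0 ?pos_coord //.
have := theta_dom_simple i; rewrite corootE euclidZr pmulr_rge0 // invr_gt0.
by rewrite nu_gt0 // simple_root.
Qed.

Lemma pos_theta : pos (theta D).
Proof.
have rth := theta_root D; apply/negPn/negP; rewrite -posN // => pN.
have := @theta_max _ _ D (- theta D).
rewrite rootN euclidNl euclidNr opprK theta_short rth => /(_ isT erefl).
rewrite opprK => th2; case/negP: (root_neq0 rth); apply/eqP/coord_eq0 => i.
apply/le_anti; rewrite -oppr_ge0 -coordN (pos_coord i pN) /=.
by have := nonneg_coord i th2; rewrite coordD; lra.
Qed.

Lemma nu_theta : nu D (theta D) = 1.
Proof. by rewrite /nu theta_short divff // pnatr_eq0. Qed.

Lemma coroot_theta : (theta D)^v = theta D.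
Proof. by rewrite corootE nu_theta invr1 scale1r. Qed.

(** As theta is short, positivity of the form on [a - theta] and [a + theta]
    bounds the integer [2 (theta, a) / (a, a)] strictly between -2 and 2. *)
Lemma theta_pairing a : a \in rt -> a != theta D -> a != - theta D ->
  [\/ (|theta D, a^v|) = 0, (|theta D, a^v|) = 1 | (|theta D, a^v|) = - 1].
Proof.
move=> ra a1 a2.
have /intrP[c cE] := roots_int ra (theta_root D).
rewrite -[crt _ a]/(a^v) in cE.
have ge2 := form_ge2 ra; have th2 := theta_short D.
have aE : (|a, theta D|) = c%:~R * (|a, a|) / 2.
  by rewrite -cE corootE euclidZr (euclidC (theta D)) /nu; field; rewrite gt_eqF ?norm_gt0.
have lt1 : c%:~R < (2 : R).
  have : 0 < (|a - theta D, a - theta D|) by rewrite gram_pos // subr_eq0.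
  rewrite !(euclidBl, euclidBr) (euclidC (theta D) a) aE th2; nra.
have lt2 : - (2 : R) < c%:~R.
  have : 0 < (|a + theta D, a + theta D|) by rewrite gram_pos // addr_eq0.
  rewrite !(euclidDl, euclidDr) (euclidC (theta D) a) aE th2; nra.
rewrite cE; move: lt1 lt2; rewrite -[2]/((2%:Z)%:~R) -rmorphN !ltr_int => lt1 lt2.
have : [\/ c = 0, c = 1 | c = -1] by case: c lt1 lt2 {cE aE} => [[|[|?]]|[|?]] //= _ _;
  [constructor 1|constructor 2|constructor 3].
by case=> ->; [constructor 1|constructor 2|constructor 3].
Qed.

(** The analogue of [neg_sr_simple] for theta. By dominance of theta the sign of
    a root not orthogonal to theta is that of its pairing with theta, and the
    pairing is 1 or -1 unless the root is theta or its opposite. *)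
Lemma neg_sr_theta a : a \in rt ->
  neg (sr (theta D) *m a) - neg a =
  (|theta D, a^v|) + (a == - theta D)%:R - (a == theta D)%:R.
Proof.
have rth := theta_root D; have pth := pos_theta.
have P b : b \in rt -> 0 <= (|theta D, b^v|) -> b != - theta D ->
    neg (sr (theta D) *m b) - neg b =
    (|theta D, b^v|) + (b == - theta D)%:R - (b == theta D)%:R.
  move=> rb t0 b2; rewrite (negbTE b2).
  have [->|b1] := eqVneq b (theta D).
    by rewrite sr_self // /neg posN // pth coroot_self //=; lra.
  have [tb|tb|tb] := theta_pairing rb b1 b2.
  - rewrite srE coroot_theta tb; suff -> : (|b, theta D|) = 0.
      by rewrite scale0r subr0; lra.
    have := tb; rewrite corootE euclidZr euclidC => /eqP.
    by rewrite mulf_eq0 invr_eq0 (negbTE (nu_neq0 rb)) => /eqP.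
  - have tb' : 0 < (|theta D, b|).
      by have := @ltr01 R; rewrite -tb corootE euclidZr pmulr_rgt0 // invr_gt0 nu_gt0.
    have pb : pos b.
      apply/negPn/negP; rewrite -posN // => /theta_dom.
      by rewrite euclidNr oppr_ge0 leNgt tb'.
    have npb : ~~ pos (sr (theta D) *m b).
      apply/negP => /theta_dom; rewrite -{1}[theta D]opprK -(sr_self rth) euclidNl.
      by rewrite (isom_sr rth).1 oppr_ge0 leNgt tb'.
    by rewrite /neg pb npb tb /=; lra.
  - by move: t0; rewrite tb; lra.
move=> ra; have [t0|t0] := leP 0 (|theta D, a^v|); last first.
  have := P (- a); rewrite rootN ra corootN euclidNr mulmxN !negN ?roots_refl //.
  have [aE|aN] := eqVneq a (theta D).
    by move: t0; rewrite aE coroot_self // ltrn0.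
  rewrite eqr_oppLR opprK (negbTE aN) (eqr_oppLR a (theta D)).
  move=> /(_ isT _ isT) H; have {}H := H ltac:(lra).
  by move: H; case: (a == - theta D) => /= H; lra.
have [aE|] := eqVneq a (- theta D); last by move=> aN; rewrite P // (negbTE aN).
by move: t0; rewrite aE corootN euclidNr coroot_self // oppr_ge0 lern0.
Qed.

End RootSystem.

(** * Words in the affine reflections *)

Section AffineWords.
Context {R : realType} {n : nat} (D : rootData R n).
Implicit Types (a b x y : 'cV[R]_n) (v : 'M[R]_n).

Local Notation aff := (Defs.aff (R := R) (n := n)).
Local Notation "(| x , y |)" := (euclid (gram D) x y).
Local Notation rt := (Defs.roots D).
Local Notation sr a := (Defs.refl (gram D) a).
Local Notation "a ^v" := (coroot D a) (at level 2, format "a ^v").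
Local Notation asimple := (aff_simple D).
Local Notation neg := (neg D).
Local Notation isom := (isom D).

Lemma aff_simpleP (j : 'I_n.+1) :
  asimple j = (- theta D, 1) \/ exists i, asimple j = (simple D i, 0).
Proof. by rewrite /aff_simple; case: unliftP => [i _|_]; [right; exists i | left]. Qed.

Lemma aff_simple_root j : (asimple j).1 \in rt.
Proof.
have [->|[i ->]] := aff_simpleP j; last exact: simple_root.
by rewrite rootN theta_root.
Qed.

(** The second component is 0 except for alpha_0, which is short. *)
Lemma aff_simple_nu j : (asimple j).2 * (nu D (asimple j).1 - 1) = 0.
Proof.
have [->|[i ->]] := aff_simpleP j; last by rewrite mul0r.
by rewrite nuN nu_theta subrr mulr0.
Qed.

(** The formulas for the simple roots and for theta become one formula for the
    simple affine roots, whose second component vanishes unless the first one is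
    the opposite of theta. *)
Lemma neg_sr_aff j a : a \in rt ->
  neg (sr (asimple j).1 *m a) - neg a =
  (a == (asimple j).1)%:R - (a == - (asimple j).1)%:R
    - (asimple j).2 * (|a^v, (asimple j).1|).
Proof.
move=> ra; have [->|[i ->]] /= := aff_simpleP j; last first.
  by rewrite neg_sr_simple // mul0r subr0.
by rewrite srN neg_sr_theta // opprK euclidNr (euclidC _ (theta D)); ring.
Qed.

Definition lin_word (js : seq 'I_n.+1) : 'M[R]_n :=
  foldr (fun j M => sr (asimple j).1 *m M) 1%:M js.

Definition shift (js : seq 'I_n.+1) x : R := (aff_word D js (x, 0)).2.

Lemma aff_word_cons j js Z :
  aff_word D (j :: js) Z = aff_refl D (asimple j) (aff_word D js Z).
Proof. by []. Qed.

Lemma aff_reflE A Z :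
  aff_refl D A Z = (sr A.1 *m Z.1, Z.2 - (|Z.1, A.1^v|) * A.2).
Proof. by rewrite /aff_refl srE. Qed.

Lemma aff_wordE js Z :
  aff_word D js Z = (lin_word js *m Z.1, Z.2 + shift js Z.1).
Proof.
elim: js Z => [|j js IH] Z; first by rewrite /shift /= mul1mx addr0; case: Z.
rewrite /shift !aff_word_cons !IH !aff_reflE /=.
by rewrite mulmxA; congr pair; ring.
Qed.

Lemma shift_cons j js x : shift (j :: js) x =
  shift js x - (|lin_word js *m x, (asimple j).1^v|) * (asimple j).2.
Proof. by rewrite /shift aff_word_cons aff_reflE aff_wordE /= add0r. Qed.

Lemma shift_lin js x c y : shift js (x - c *: y) = shift js x - c * shift js y.
Proof.
elim: js => [|j js IH]; first by rewrite /shift /= mulr0 subr0.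
rewrite !shift_cons IH mulmxBr -scalemxAr euclidBl euclidZl; ring.
Qed.

Lemma aff_word_cat s1 s2 Z :
  aff_word D (s1 ++ s2) Z = aff_word D s1 (aff_word D s2 Z).
Proof. by elim: s1 => //= j s1 <-. Qed.

Lemma aff_reflK A Z : A.1 \in rt -> aff_refl D A (aff_refl D A Z) = Z.
Proof.
move=> rA; case: Z => x c; rewrite !aff_reflE /= srK //; congr pair.
rewrite srE euclidBl euclidZl coroot_self //; ring.
Qed.

Lemma aff_word_revK js Z : aff_word D (rev js) (aff_word D js Z) = Z.
Proof.
elim: js Z => // j js IH Z; rewrite rev_cons -cats1 aff_word_cat /=.
by rewrite aff_reflK ?IH ?aff_simple_root.
Qed.

Lemma isom_lin_word js : isom (lin_word js).
Proof.
by elim: js => [|j js IH]; [exact: isom1 | exact/isomM/IH/isom_sr/aff_simple_root].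
Qed.

Lemma lin_word_revK js x : lin_word (rev js) *m (lin_word js *m x) = x.
Proof. by have := aff_word_revK js (x, 0); rewrite !aff_wordE /= => -[]. Qed.

Local Notation ars := (aff_root_seq D).

Lemma ars_rcons js j : ars (rcons js j) = rcons (ars js) (aff_word D js (asimple j)).
Proof.
rewrite /aff_root_seq size_rcons -[in iota _ _]addn1 iotaD cats1 zip_rcons ?size_iota //.
rewrite map_rcons /=; have -> : take (0 + size js) (rcons js j) = js.
  by rewrite -cats1 take_size_cat.
congr rcons.
apply/eq_in_map => -[i k] /(map_f (@fst _ _)); rewrite -/unzip1 unzip1_zip ?size_iota //.
by rewrite mem_iota /= add0n => li; rewrite -cats1 takel_cat // ltnW.
Qed.

Lemma ars_cat s1 s2 : ars (s1 ++ s2) = ars s1 ++ map (aff_word D s1) (ars s2).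
Proof.
elim/last_ind: s2 => [|s2 j IH]; first by rewrite !cats0.
by rewrite -rcons_cat !ars_rcons IH map_rcons aff_word_cat rcons_cat.
Qed.

Lemma size_ars js : size (ars js) = size js.
Proof. by rewrite size_map size_zip size_iota minnn. Qed.

Lemma ars_root js A : A \in ars js -> A.1 \in rt.
Proof.
elim/last_ind: js => // js j IH; rewrite ars_rcons mem_rcons inE.
case/predU1P => [->|/IH//]; rewrite aff_wordE /=.
exact/(isom_lin_word js).2/aff_simple_root.
Qed.

Lemma aff_wordN js Z : aff_word D js (aff_opp Z) = aff_opp (aff_word D js Z).
Proof.
rewrite !aff_wordE /aff_opp /= mulmxN; congr pair.
have := shift_lin js 0 1 Z.1; rewrite sub0r scale1r => ->.
have := shift_lin js 0 1 0; rewrite scaler0 subr0; lra.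
Qed.

(** The roots of the reversed word are, up to sign, the images of the roots of
    the word, in reversed order: reading a word from the other end exchanges the
    sequences alpha^p ... alpha^r and - alpha^r ... - alpha^p. *)
Lemma ars_rev js :
  ars (rev js) = rev (map (@aff_opp R n \o aff_word D (rev js)) (ars js)).
Proof.
elim/last_ind: js => // js j IH; rewrite rev_rcons -cat1s ars_cat IH ars_rcons.
rewrite map_rcons rev_rcons map_rev -map_comp /= aff_word_revK; congr cons.
  have rj := aff_simple_root j.
  rewrite aff_reflE /= coroot_self // sr_self // /aff_opp /= opprK.
  by case: (asimple j) => x c /=; congr pair; ring.
congr rev; apply: eq_map => Z /=.
by have := aff_wordN [:: j] (aff_word D (rev js) Z) => /= ->.
Qed.


(** Counting a root with multiplicity 1 and its opposite with multiplicity -1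
    makes the count a sum of an additive function of the coroot and of two
    indicators, for every word, reduced or not. *)
Definition signed_count (N : seq aff) a : R :=
  \sum_(A <- N) ((A.1 == a)%:R - (A.1 == - a)%:R).

(** Induction on the word: a new letter changes the indicator of negativity by
    [neg_sr_aff], and the term of [neg_sr_aff] with the pairing is the change of
    the shift. *)
Lemma signed_count_ars js a : a \in rt ->
  signed_count (ars js) a =
  neg (lin_word (rev js) *m a) - neg a - shift (rev js) a / nu D a.
Proof.
move=> ra; elim/last_ind: js => [|js j IH].
  by rewrite /signed_count big_nil /= mul1mx /shift /= mul0r; ring.
rewrite ars_rcons rev_rcons /signed_count -cats1 big_cat big_seq1 /= -/(signed_count _ _).
rewrite IH shift_cons aff_wordE /=.
set w := lin_word (rev js); set b := w *m a.
have iw : isom w := isom_lin_word _; have rb : b \in rt by exact: iw.2.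
have E c : (lin_word js *m (asimple j).1 == c) = (w *m c == (asimple j).1).
  apply/eqP/eqP => <-; first by rewrite lin_word_revK.
  by have := lin_word_revK (rev js) c; rewrite revK.
rewrite !E mulmxN eqr_oppLR -/b -mulmxA -/w -/b.
have := neg_sr_aff j rb; rewrite corootE (isom_nu a iw) euclidZl.
have := aff_simple_nu j; set m := nu D (asimple j).1 => hm.
rewrite corootE euclidZr -/m.
have na := nu_neq0 ra; have nm := nu_neq0 (aff_simple_root j); rewrite -/m in nm.
set t := (|b, _|).
have -> : (shift (rev js) a - m^-1 * t * (asimple j).2) / nu D a =
  shift (rev js) a / nu D a - (asimple j).2 * ((nu D a)^-1 * t).
  suff -> : m^-1 * t * (asimple j).2 = t * (asimple j).2 by field.
  apply: (mulfI nm); rewrite -[X in X = _]/(m * _) mulrA mulrA mulfV // mul1r.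
  by apply/eqP; rewrite -subr_eq0; apply/eqP; rewrite -[RHS](mulr0 (- t)) -hm; ring.
lra.
Qed.

End AffineWords.

(** * The key inequality *)

Section KeyInequality.
Context {R : realType} {n : nat} (D : rootData R n) (z : R).
Implicit Types (a b x y : 'cV[R]_n) (v : 'M[R]_n).

Local Notation aff := (Defs.aff (R := R) (n := n)).
Local Notation "(| x , y |)" := (euclid (gram D) x y).
Local Notation rt := (Defs.roots D).
Local Notation sr a := (Defs.refl (gram D) a).
Local Notation pos := (pos_root D).
Local Notation "a ^v" := (coroot D a) (at level 2, format "a ^v").
Local Notation neg := (neg D).
Local Notation isom := (isom D).
Local Notation asimple := (aff_simple D).
Local Notation ars := (aff_root_seq D).

(** The exponent of [t_z^(1/2)] in q^(rho_k, x), see [rhov_height2]. For a root x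
    it is twice the sum of its coordinates at the simple roots of length z. *)
Definition height2 x : R := \sum_(a <- rt | pos a && (nu D a == z)) (|x, a^v|).

Definition turn v a b : R := neg (v *m (sr a *m b)) - neg (v *m b).

(** Keeping only the terms at a and at its opposite. *)
Lemma sum_root_ge_pair (F : 'cV[R]_n -> R) a : a \in rt ->
  (forall b, b \in rt -> 0 <= F b) ->
  (nu D a == z)%:R * (F a + F (- a)) <= \sum_(b <- rt | nu D b == z) F b.
Proof.
move=> ra F0; have [az|] := boolP (nu D a == z); last first.
  by rewrite mul0r big_seq_cond sumr_ge0 // => b /andP[/F0].
have aN : - a != a.
  by rewrite eq_sym -addr_eq0 -mulr2n -scaler_nat scaler_eq0 pnatr_eq0 (root_neq0 ra).
rewrite mul1r -big_filter (bigD1_seq a) ?filter_uniq ?fset_uniq ?mem_filter ?az //=.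
rewrite lerD2l -big_filter (bigD1_seq (- a)) ?filter_uniq ?fset_uniq //=; last first.
  by rewrite !mem_filter aN nuN az rootN.
rewrite lerDl big_seq_cond sumr_ge0 // => b /andP[].
by rewrite !mem_filter => /and3P[_ _ /F0].
Qed.

Lemma turnN v a b : isom v -> a \in rt -> b \in rt -> turn v a (- b) = - turn v a b.
Proof.
move=> iv ra rb; rewrite /turn !mulmxN !negN ?iv.2 //; last exact/(isom_sr ra).2.
ring.
Qed.

Lemma turn_sr v a b : a \in rt -> turn v a (sr a *m b) = - turn v a b.
Proof. by move=> ra; rewrite /turn srK // opprB. Qed.

Lemma turn_self v a : isom v -> a \in rt -> turn v a a = 1 - 2 * neg (v *m a).
Proof. move=> iv ra; rewrite /turn sr_self // mulmxN negN ?iv.2 //; ring. Qed.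

Lemma turn_bound v a b : `|turn v a b| <= 1.
Proof.
rewrite /turn /neg; case: (pos _); case: (pos _) => /=;
  by rewrite ?subrr ?sub0r ?subr0 ?normrN ?normr1 ?normr0.
Qed.

(** The opposite roots contribute the same with the opposite sign of the pairing,
    so positivity can be traded for negativity. *)
Lemma height2E x : height2 x = - \sum_(a <- rt | nu D a == z) neg a * (|x, a^v|).
Proof.
rewrite (sum_rootN D) -sumrN /height2 big_mkcondl /= big_seq_cond.
rewrite [RHS]big_seq_cond; apply: eq_big => [a|a /andP[ra _]]; first by rewrite nuN.
rewrite corootN euclidNr mulrN opprK negN // /neg.
by case: (pos a); rewrite /= ?subr0 ?subrr ?mul1r ?mul0r.
Qed.

(** Reindexing the sum of [height2E] by the reflection in a changes the sign of
    the pairings; the average of the two forms is expressed by [turn]. *)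
Lemma height2_turn v a : isom v -> a \in rt ->
  2 * height2 (v *m a) = \sum_(b <- rt | nu D b == z) turn v a b * (|a, b^v|).
Proof.
move=> iv ra; have is_ := isom_sr ra.
have E : height2 (v *m a) = - \sum_(b <- rt | nu D b == z) neg (v *m b) * (|a, b^v|).
  rewrite height2E (sum_isom _ _ iv); congr (- _).
  by apply: eq_big => [b|b _]; rewrite ?isom_nu ?isom_coroot // iv.1.
have E2 : height2 (v *m a) =
    \sum_(b <- rt | nu D b == z) neg (v *m (sr a *m b)) * (|a, b^v|).
  rewrite E (sum_isom _ _ is_) -sumrN.
  apply: eq_big => [b|b _]; rewrite ?isom_nu ?isom_coroot //.
  by rewrite -[a in (|a, _|)](srK _ ra) is_.1 sr_self // euclidNl mulrN opprK.
rewrite mulr2n mulrDl mul1r {1}E E2 addrC -sumrN -big_split /=.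
by apply: eq_bigr => b _; rewrite /turn mulrBl.
Qed.

Lemma root_pairing_int a b : a \in rt -> b \in rt ->
  exists c : int, (|b, a^v|) = c%:~R.
Proof. by move=> ra rb; apply/intrP; exact: roots_int. Qed.

Lemma pairing_swap a b : a \in rt -> b \in rt ->
  (|a, b^v|) = (|b, a^v|) * (nu D a / nu D b).
Proof.
move=> ra rb; rewrite !corootE !euclidZr (euclidC D a b).
by field; rewrite !nu_neq0.
Qed.

(** [v b] and its image under the reflection in [v a] differ by a multiple of
    [v a] of known sign, so the sign of [v b] can only change in one direction. *)
Lemma turn_sign v a b : isom v -> a \in rt -> b \in rt -> 0 <= (|a, b^v|) ->
  0 <= (1 - 2 * neg (v *m a)) * turn v a b.
Proof.
move=> iv ra rb; rewrite pairing_swap // (pmulr_lge0 _ (divr_gt0 (nu_gt0 ra) (nu_gt0 rb))) => c0.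
set c := (|b, a^v|) in c0; have rva := iv.2 _ ra; have rvb := iv.2 _ rb.
have rvs : v *m (sr a *m b) \in rt by exact/iv.2/(isom_sr ra).2.
have e1 : v *m b = v *m (sr a *m b) + c *: (v *m a).
  by rewrite srE mulmxBr -scalemxAr subrK.
have e2 : v *m (sr a *m b) = v *m b + c *: - (v *m a).
  by rewrite srE mulmxBr -scalemxAr scalerN.
rewrite /turn /neg; have [pa|npa] := boolP (pos (v *m a)).
  rewrite mulr0 subr0 mul1r; have [ps|_] := boolP (pos (v *m (sr a *m b))).
    by rewrite e1 pos_addZ // -?e1 //= subrr.
  by rewrite subr_ge0; case: (pos _).
have [pb|_] := boolP (pos (v *m b)).
  by rewrite e2 pos_addZ // -?e2 ?posN //= subrr mulr0.
by case: (pos _); rewrite /=; lra.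
Qed.

(** If the reflection moves b, integrality makes the pairing at least 1 in
    absolute value. *)
Lemma turn_sign_pairing v a b : isom v -> a \in rt -> b \in rt ->
  turn v a b = 0 \/
  0 <= (1 - 2 * neg (v *m a)) * turn v a b /\ 1 <= (|a, b^v|) \/
  (1 - 2 * neg (v *m a)) * turn v a b <= 0 /\ (|a, b^v|) <= - 1.
Proof.
move=> iv ra rb; have [c cE] := root_pairing_int rb ra.
have [c0|c0|c0] := ltrgt0P c; last 1 first.
- left; rewrite c0 in cE; rewrite /turn srE.
  move: cE; rewrite pairing_swap // => /eqP; rewrite mulf_eq0 => /orP[/eqP->|].
    by rewrite scale0r subr0 subrr.
  by rewrite mulf_eq0 invr_eq0 !(negbTE (nu_neq0 _)).
- right; left; split; last by rewrite cE -[1]/(1%:~R) ler_int.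
  by apply: turn_sign => //; rewrite cE ler0z ltW.
- right; right; split; last first.
    by rewrite cE -[-1]/((-1)%:~R) ler_int; lia.
  rewrite -oppr_ge0 -mulrN -turnN //; apply: turn_sign; rewrite ?rootN //.
  by rewrite corootN euclidNr cE oppr_ge0 lerz0 ltW.
Qed.

(** As [turn] is odd, a sum over the roots of a word is half a sum over all roots
    weighted by the signed counts. *)
Lemma sum_signed_count_turn v (N : seq aff) a : isom v -> a \in rt ->
  {in N, forall A, A.1 \in rt} ->
  2 * \sum_(A <- N | nu D A.1 == z) turn v a A.1 =
  \sum_(b <- rt | nu D b == z) signed_count N b * turn v a b.
Proof.
move=> iv ra rN; under [RHS]eq_bigr => b _ do rewrite /signed_count mulr_suml.
rewrite exchange_big /= mulr_sumr big_mkcond /= big_seq [RHS]big_seq.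
apply: eq_bigr => A /rN rA.
have S b : b \in rt -> \sum_(c <- rt | nu D c == z) (b == c)%:R * turn v a c =
    if nu D b == z then turn v a b else 0.
  move=> rb; rewrite big_mkcond (bigD1_seq b rb (fset_uniq _)) /= eqxx mul1r big1 ?addr0 // => c.
  by rewrite eq_sym => /negbTE ->; rewrite mul0r if_same.
have := S _ rA; have := S (- A.1); rewrite rootN nuN => /(_ rA) S1 S2.
under eq_bigr => b _ do rewrite mulrBl.
rewrite sumrB S2; under eq_bigr => b _ do rewrite -eqr_oppLR.
by rewrite S1 turnN //; case: ifP => _; ring.
Qed.

(** The first factor taken from a product with a reflection replaces [v] by
    [v *m sr A.1] in the costs of all roots [B] of the remaining word. The change
    of these costs is a sum of [turn]s; by [sum_signed_count_turn] and
    [signed_count_ars] it is a sum over all roots b of length z of [turn v a b]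
    with coefficients [(|a, b^v|) * J + turn 1 a b], up to two terms at a and -a.
    By [height2_turn] the part with J is exactly the order of the translation in
    [s_aff]. What remains is compared with the order of [g] term by term, all
    terms having the same sign by [turn_sign_pairing]; the terms at a and -a
    provide the order of [f]. *)
Theorem key_ineq v js j A : isom v -> A = aff_word D js (asimple j) -> pos A.1 ->
  2 * ((nu D A.1 == z) && ~~ pos (v *m A.1))%:R +
    2 * \sum_(B <- ars js | nu D B.1 == z) neg (v *m B.1) <=
  Num.max 0 (- height2 (v *m A.1)) - A.2 / nu D A.1 * height2 (v *m A.1) +
    2 * \sum_(B <- ars js | nu D B.1 == z) neg (v *m (sr A.1 *m B.1)).
Proof.
move=> iv AE; set a := A.1; set J := A.2 / _ => pA.
have ra := pos_mem pA; have is_ := isom_sr ra.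
rewrite -subr_ge0; set lhs := (X in 0 <= X).
have sumE : 2 * \sum_(B <- ars js | nu D B.1 == z) turn v a B.1 =
    2 * \sum_(B <- ars js | nu D B.1 == z) neg (v *m (sr a *m B.1)) -
    2 * \sum_(B <- ars js | nu D B.1 == z) neg (v *m B.1).
  by rewrite -mulrBr -sumrB.
(* The shift is additive and the letter [j] maps A to a simple affine root, so
   the difference of the signed counts at b and at its reflection is explicit. *)
have cntB b : b \in rt ->
    signed_count (ars js) b - signed_count (ars js) (sr a *m b) =
    (|a, b^v|) * J + turn 1%:M a b - (b == a)%:R + (b == - a)%:R.
  move=> rb; have rsb := is_.2 _ rb; rewrite !signed_count_ars //.
  set w := lin_word D (rev js); have iw : isom w := isom_lin_word _ _.
  have wa : w *m a = (asimple j).1.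
    by rewrite /a AE aff_wordE /= lin_word_revK.
  have shA : shift D (rev js) a = (asimple j).2 - A.2.
    have := aff_word_revK D js (asimple j); rewrite -AE [LHS]aff_wordE.
    by move=> /(congr1 snd) /= <-; rewrite -/a; ring.
  have sb : w *m (sr a *m b) = sr (asimple j).1 *m (w *m b).
    by rewrite -wa isom_refl.
  have := neg_sr_aff j (iw.2 _ rb); rewrite -sb (isom_coroot b iw) -wa iw.1.
  rewrite -mulmxN !(inj_eq (isom_inj iw)) (euclidC D _ a) => E.
  rewrite (isom_nu b is_) srE shift_lin shA /turn !mul1mx -srE.
  have J2 : (asimple j).2 * (nu D a - 1) = 0.
    by rewrite -(isom_nu a iw) wa aff_simple_nu.
  have na := nu_neq0 ra; have nb := nu_neq0 rb.
  have cE : (|b, a^v|) = (|a, b^v|) * (nu D b / nu D a) by rewrite pairing_swap.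
  have -> : (shift D (rev js) b - (|b, a^v|) * ((asimple j).2 - A.2)) / nu D b =
      shift D (rev js) b / nu D b - (|a, b^v|) * ((asimple j).2 / nu D a - J).
    by rewrite cE /J; field; rewrite na nb.
  have -> : (asimple j).2 / nu D a = (asimple j).2.
    by apply: (mulIf na); rewrite mulfVK //; move: J2; rewrite mulrBr mulr1 => /subr0_eq.
  lra.
(* Folding the sum over all roots by the reflection in a. *)
have sum2 : 4 * \sum_(B <- ars js | nu D B.1 == z) turn v a B.1 =
    2 * J * height2 (v *m a) - 2 * (nu D a == z)%:R * turn v a a +
    \sum_(b <- rt | nu D b == z) turn 1%:M a b * turn v a b.
  have E := sum_signed_count_turn iv ra (@ars_root _ _ D js).
  have E' := E; rewrite (sum_isom _ _ is_) in E'.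
  have {E E'} -> : 4 * \sum_(B <- ars js | nu D B.1 == z) turn v a B.1 =
    \sum_(b <- rt | nu D b == z)
      (signed_count (ars js) b - signed_count (ars js) (sr a *m b)) * turn v a b.
    under [RHS]eq_bigr => b _ do rewrite mulrBl; rewrite [RHS]sumrB -E.
    have -> : \sum_(b <- rt | nu D b == z)
        signed_count (ars js) (sr a *m b) * turn v a b =
      - \sum_(b <- rt | nu D (sr a *m b) == z)
        signed_count (ars js) (sr a *m b) * turn v a (sr a *m b).
      rewrite -sumrN; apply: eq_big => [b|b _]; first by rewrite isom_nu.
      by rewrite turn_sr // mulrN opprK.
    by rewrite -E'; ring.
  rewrite big_seq_cond.
  under eq_bigr => b /andP[rb _].
    rewrite cntB // (_ : _ * turn v a b = (|a, b^v|) * J * turn v a b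
      + - ((b == a)%:R * turn v a b) + (b == - a)%:R * turn v a b
      + turn 1%:M a b * turn v a b); last by ring.
    over.
  rewrite -big_seq_cond !big_split /= sumrN.
  have -> : \sum_(b <- rt | nu D b == z) (|a, b^v|) * J * turn v a b =
      2 * J * height2 (v *m a).
    rewrite -mulrA mulrCA height2_turn // mulr_sumr.
    by apply: eq_bigr => b _; ring.
  have S c : c \in rt -> \sum_(b <- rt | nu D b == z) (b == c)%:R * turn v a b =
      (nu D c == z)%:R * turn v a c.
    move=> rc; rewrite big_mkcond (bigD1_seq c rc (fset_uniq _)) /= eqxx mul1r big1 ?addr0.
      by case: ifP; rewrite ?mul1r ?mul0r.
    by move=> b /negbTE ->; rewrite mul0r if_same.
  rewrite !S ?rootN // turnN // nuN; ring.
have ta := turn_self iv ra; have t1 := turn_self (isom1 D) ra.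
rewrite mul1mx /neg pA mulr0 subr0 in t1.
have h2 := height2_turn iv ra.
have lhsE : lhs = Num.max 0 (- height2 (v *m a)) - J * height2 (v *m a)
   - 2 * ((nu D a == z) && ~~ pos (v *m a))%:R
   + 2 * \sum_(B <- ars js | nu D B.1 == z) turn v a B.1.
  by rewrite sumE /lhs; ring.
(* If [v a] is positive then [g] has order 0 and the terms at a and -a suffice;
   otherwise the order of [g] cancels the part with the pairings. *)
have [pva|npva] := boolP (pos (v *m a)).
  have turn1 : turn v a a = 1 by rewrite ta /neg pva mulr0 subr0.
  have m0 : 0 <= Num.max 0 (- height2 (v *m a)) by rewrite le_max lexx.
  have F0 b : b \in rt -> 0 <= turn 1%:M a b * turn v a b.
    move=> rb.
    have [->|[[t c]|[t c]]] := turn_sign_pairing iv ra rb; first by rewrite mulr0.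
      have [->|[[t' _]|[_ c']]] := turn_sign_pairing (isom1 D) ra rb; first by rewrite mul0r.
        move: t t'; rewrite mul1mx /neg pva pA /= mulr0 subr0 !mul1r.
        by move=> ? ?; rewrite mulr_ge0.
      lra.
    have [->|[[_ c']|[t' _]]] := turn_sign_pairing (isom1 D) ra rb; first by rewrite mul0r.
      lra.
    move: t t'; rewrite mul1mx /neg pva pA /= mulr0 subr0 !mul1r.
    by move=> ? ?; rewrite mulr_le0.
  have := sum_root_ge_pair ra F0.
  rewrite !(turnN (isom1 D) ra ra) !(turnN iv ra ra) t1 turn1.
  by rewrite lhsE pva andbF /= turn1 in sum2 *; lra.
have turn1 : turn v a a = - 1 by rewrite ta /neg npva /=; ring.
have m0 : - height2 (v *m a) <= Num.max 0 (- height2 (v *m a)).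
  by rewrite le_max lexx orbT.
have F0 b : b \in rt -> 0 <= turn 1%:M a b * turn v a b - turn v a b * (|a, b^v|).
  move=> rb.
  have := turn_bound 1%:M a b; rewrite ler_norml => /andP[b1 b2].
  have [->|[[t c]|[t c]]] := turn_sign_pairing iv ra rb; first by rewrite mulr0 mul0r subrr.
    have t0 : turn v a b <= 0 by move: t; rewrite /neg npva /=; lra.
    by rewrite (mulrC (turn v a b)) -mulrBl mulr_le0 // subr_le0; lra.
  have t0 : 0 <= turn v a b by move: t; rewrite /neg npva /=; lra.
  by rewrite (mulrC (turn v a b)) -mulrBl mulr_ge0 // subr_ge0; lra.
have := sum_root_ge_pair ra F0; rewrite [X in _ <= X]sumrB -h2.
rewrite !(turnN (isom1 D) ra ra) !(turnN iv ra ra) t1 turn1 corootN euclidNr.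
by rewrite coroot_self // lhsE npva andbT; rewrite turn1 in sum2; lra.
Qed.

End KeyInequality.

(** * Costs of the products in an expansion *)

Section Totals.
Context {R : realType} {n : nat} (D : rootData R n) (z : R).
Implicit Types (a b x y : 'cV[R]_n) (v : 'M[R]_n).

Local Notation aff := (Defs.aff (R := R) (n := n)).
Local Notation sr a := (Defs.refl (gram D) a).
Local Notation pos := (pos_root D).
Local Notation neg := (neg D).
Local Notation isom := (isom D).
Local Notation ars := (aff_root_seq D).
Local Notation height2 := (height2 D z).

(** The orders in [t_z^(1/2)] of the factors [f] and [g] at a root a, as functions
    of [v], the inverse of the element w of the Weyl group; see [kappa_factor]. *)
Definition f_cost v a : R := 2 * ((nu D a == z) && ~~ pos (v *m a))%:R.
Definition g_cost v a : R := Num.max 0 (- height2 (v *m a)).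

(** The order of a product in the expansion: [cs] lists the choices, [true] for
    [f]. A chosen reflection changes [v] for all factors behind it and
    contributes the order of its translation. The sign [e] is 1 when the
    reflections are moved to the right and -1 when they are moved to the left. *)
Fixpoint total (e : R) v (As : seq aff) (cs : seq bool) : R :=
  match As, cs with
  | A :: As', c :: cs' =>
      if c then f_cost v A.1 + total e v As' cs'
      else g_cost v A.1 - e * (A.2 / nu D A.1 * height2 (v *m A.1))
        + total e (v *m sr A.1) As' cs'
  | _, _ => 0
  end.

Lemma isom_sr_comm v a : isom v -> sr (v *m a) *m v = v *m sr a.
Proof.
move=> iv; apply/matrixP => i j; have := isom_refl a (delta_mx j 0) iv.
by rewrite !mulmxA -!colE => /matrixP /(_ i 0); rewrite !mxE.
Qed.

(** Linear changes of the sequence of roots can be absorbed in [v]. With [- 1] in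
    place of [y] this relates the two signs of [e]. *)
Lemma total_map (g : aff -> aff) e e' v (y : 'M[R]_n) (As : seq aff) cs : isom y ->
  {in As, forall A, (g A).1 = y *m A.1 /\ e' * (g A).2 = e * A.2} ->
  total e' v (map g As) cs = total e (v *m y) As cs.
Proof.
move=> iy; elim: As cs v => [|A As IH] [|c cs] v //= H.
have [g1 g2] := H A (mem_head _ _); rewrite /f_cost /g_cost g1 isom_nu // mulmxA.
have HI : {in As, forall A, (g A).1 = y *m A.1 /\ e' * (g A).2 = e * A.2}.
  by move=> B BAs; apply: H; rewrite inE BAs orbT.
rewrite !IH // -[v *m _ *m y]mulmxA isom_sr_comm // mulmxA.
by rewrite !mulrA g2.
Qed.

Lemma sum_f_cost v (As : seq aff) : \sum_(A <- As) f_cost v A.1 =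
  2 * \sum_(A <- As | nu D A.1 == z) neg (v *m A.1).
Proof.
rewrite mulr_sumr [RHS]big_mkcond; apply: eq_bigr => A _.
by rewrite /f_cost /neg; case: eqP; rewrite ?mulr0.
Qed.

(** Induction on the word: its last root comes first in the product, and
    [key_ineq] compares the costs of the other roots before and after the
    reflection. *)
Theorem total_ge v js cs : isom v -> {in ars js, forall A, pos A.1} ->
  size cs = size js ->
  \sum_(A <- ars js) f_cost v A.1 <= total 1 v (rev (ars js)) cs.
Proof.
elim/last_ind: js v cs => [|js j IH] v cs iv; first by rewrite big_nil; case: cs.
rewrite ars_rcons rev_rcons -cats1 big_cat big_seq1 /=; set A := aff_word _ _ _.
move=> H; have pA : pos A.1 by apply: H; rewrite mem_cat mem_head orbT.
have {}H : {in ars js, forall A, pos A.1} by move=> B B1; apply: H; rewrite mem_cat B1.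
case: cs => [|[] cs]; rewrite size_rcons // => -[sz].
  by rewrite addrC lerD2l IH.
have is_ := isom_sr (pos_mem pA).
have le1 := IH _ _ (isomM iv is_) H sz.
have le2 := key_ineq z iv (erefl A) pA.
move: le1; rewrite mul1r !sum_f_cost; under eq_bigr => B _ do rewrite -mulmxA.
move=> le1; rewrite addrC /f_cost /g_cost.
by apply: (le_trans le2); rewrite lerD2l.
Qed.

Corollary total_ge_map (g : aff -> aff) e v (y : 'M[R]_n) js cs :
  isom v -> isom y -> {in ars js, forall A, pos A.1} -> size cs = size js ->
  {in ars js, forall A, (g A).1 = y *m A.1 /\ e * (g A).2 = A.2} ->
  \sum_(A <- map g (rev (ars js))) f_cost v A.1 <=
    total e v (map g (rev (ars js))) cs.
Proof.
move=> iv iy pA sz gE.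
rewrite (@total_map g 1 e v y) //; last first.
  by move=> A; rewrite mem_rev mul1r => /gE.
have := total_ge (isomM iv iy) pA sz; apply: le_trans.
rewrite big_map (perm_big (ars js)) /=; last by rewrite perm_rev.
rewrite big_seq [leRHS]big_seq ler_sum // => A /[dup] /gE [g1 _] Ain.
by rewrite /f_cost g1 isom_nu // mulmxA.
Qed.

End Totals.

(** * Reduced words and positive affine roots *)

Section Positivity.
Context {R : realType} {n : nat} (D : rootData R n).
Implicit Types (a b x y : 'cV[R]_n) (v : 'M[R]_n).

Local Notation aff := (Defs.aff (R := R) (n := n)).
Local Notation "(| x , y |)" := (euclid (gram D) x y).
Local Notation rt := (Defs.roots D).
Local Notation pos := (pos_root D).
Local Notation "a ^v" := (coroot D a) (at level 2, format "a ^v").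
Local Notation neg := (neg D).
Local Notation asimple := (aff_simple D).
Local Notation ars := (aff_root_seq D).

Definition aff_root (A : aff) :=
  A.1 \in rt /\ exists c : int, A.2 = nu D A.1 * c%:~R.

Definition aff_pos (A : aff) : bool := (0 < A.2) || (A.2 == 0) && pos A.1.

(** For an affine root the two cases of positivity are one inequality between
    integers. *)
Lemma aff_posE A (c : int) : A.1 \in rt -> A.2 = nu D A.1 * c%:~R ->
  aff_pos A = (neg A.1 <= c%:~R).
Proof.
move=> rA E; have n0 := nu_gt0 rA.
rewrite /aff_pos E pmulr_rgt0 // mulf_eq0 (gt_eqF n0) /= ltr0z intr_eq0 /neg.
by rewrite -[(~~ _)%:R]/((~~ pos A.1)%:~R) ler_int; case: (pos A.1) => /=; lia.
Qed.

Lemma aff_simple2 j : (asimple j).2 = neg (asimple j).1.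
Proof.
have [->|[i ->]] := aff_simpleP D j; rewrite /= /neg ?pos_simple //.
by rewrite posN ?theta_root // pos_theta.
Qed.

Lemma aff_simple2_nu j : (asimple j).2 = nu D (asimple j).1 * (asimple j).2.
Proof. by have /eqP := aff_simple_nu D j; rewrite mulrBr mulr1 subr_eq0 mulrC => /eqP. Qed.

Lemma aff_root_simple j : aff_root (asimple j).
Proof.
split; first exact: aff_simple_root.
exists (~~ pos (asimple j).1 : nat); rewrite {1}aff_simple2_nu aff_simple2.
by rewrite /neg; case: (pos _).
Qed.

Lemma aff_pos_simple j : aff_pos (asimple j).
Proof.
rewrite (@aff_posE _ (~~ pos (asimple j).1 : nat)) ?aff_simple_root //.
by rewrite {1}aff_simple2_nu aff_simple2 /neg; case: (pos _).
Qed.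

Lemma aff_refl_simple2 j A (c : int) : A.1 \in rt -> A.2 = nu D A.1 * c%:~R ->
  exists2 d : int, d%:~R = c%:~R - (asimple j).2 * (|A.1^v, (asimple j).1|) &
  (aff_refl D (asimple j) A).2 = nu D A.1 * d%:~R.
Proof.
move=> rA E; have rj := aff_simple_root D j.
have [t tE] := root_pairing_int rA rj.
exists (c - (~~ pos (asimple j).1 : nat)%:Z * t).
  rewrite rmorphB rmorphM /= -tE aff_simple2 /neg (euclidC D A.1^v).
  by case: (pos _).
rewrite aff_reflE rmorphB rmorphM /= -tE mulrBr E; congr (_ - _).
have n1 := nu_neq0 rA; have n2 := nu_neq0 rj.
have -> : (~~ pos (asimple j).1 : nat)%:Z%:~R = (asimple j).2.
  by rewrite aff_simple2 /neg; case: (pos _).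
rewrite {1}aff_simple2_nu !corootE !euclidZr (euclidC D A.1).
by field; rewrite n1.
Qed.

Lemma aff_root_refl j A : aff_root A -> aff_root (aff_refl D (asimple j) A).
Proof.
move=> [rA [c E]]; have rj := aff_simple_root D j.
have [d _ E2] := aff_refl_simple2 j rA E.
split; first by rewrite aff_reflE /=; exact: (isom_sr rj).2.
by exists d; rewrite E2 aff_reflE /= isom_nu //; exact: isom_sr.
Qed.

(** By [neg_sr_aff] the bound in [aff_posE] moves along with the integer, except at
    the simple root itself, where it moves by 1 too much. *)
Lemma aff_pos_refl j A : aff_root A -> aff_pos A -> A <> asimple j ->
  aff_pos (aff_refl D (asimple j) A).
Proof.
move=> [rA [c E]]; have rj := aff_simple_root D j.
have [d dE E2] := aff_refl_simple2 j rA E.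
have is_ := isom_sr rj; have na := nu_gt0 rA.
have E3 : (aff_refl D (asimple j) A).2 = nu D (aff_refl D (asimple j) A).1 * d%:~R.
  by rewrite E2 aff_reflE /= isom_nu.
rewrite (aff_posE _ E) // (aff_posE _ E3); last by rewrite aff_reflE /= is_.2.
rewrite aff_reflE /= dE => le1 neA; have := neg_sr_aff j rA.
have [A1|] := eqVneq A.1 (asimple j).1; last first.
  by move=> _; case: (_ == _) => /= ?; lra.
have -> : (A.1 == - (asimple j).1) = false.
  rewrite A1; apply/negP => /eqP e; have := negN rj; rewrite -e.
  by rewrite /neg; case: (pos _) => /=; lra.
have : c%:~R != neg A.1.
  apply/eqP => cE; apply: neA; case: (A) A1 E cE => a1 a2 /= -> -> ->.
  by rewrite -aff_simple2 -aff_simple2_nu -surjective_pairing.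
rewrite /neg in le1 *; move: le1; rewrite -[(~~ pos A.1)%:R]/((~~ pos A.1)%:~R).
rewrite ler_int eqr_int => l1 l2; have l3 : ((~~ pos A.1 : nat)%:Z + 1 <= c) by lia.
by move: l3; rewrite -(ler_int R) rmorphD /=; lra.
Qed.

Lemma aff_root_word js A : aff_root A -> aff_root (aff_word D js A).
Proof. by move=> rA; elim: js => //= j js; exact: aff_root_refl. Qed.

Lemma ars_aff_root js : {in ars js, forall A, aff_root A}.
Proof.
elim/last_ind: js => // js j IH A; rewrite ars_rcons mem_rcons inE.
by case/predU1P => [->|/IH//]; exact/aff_root_word/aff_root_simple.
Qed.

Lemma aff_word_conj js A W :
  aff_refl D (aff_word D js A) (aff_word D js W) = aff_word D js (aff_refl D A W).
Proof.
have iw := isom_lin_word D js.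
rewrite !aff_wordE !aff_reflE /= isom_refl // isom_coroot // iw.1.
by congr pair; rewrite srE shift_lin; ring.
Qed.

Lemma aff_word_revKr js Z : aff_word D js (aff_word D (rev js) Z) = Z.
Proof. by have := aff_word_revK D (rev js) Z; rewrite revK. Qed.

Lemma eq_aff_word_rev s t : aff_word D s =1 aff_word D t ->
  aff_word D (rev s) =1 aff_word D (rev t).
Proof. by move=> e Z; rewrite -{1}(aff_word_revKr t Z) -e aff_word_revK. Qed.

(** A word in which no two letters can be dropped in the way of the exchange
    condition. Unlike being reduced, this does not refer to the group in which
    lengths are measured, it passes to subwords, and finite and affine reduced
    words both have it. *)
Definition exchange_free js := forall pre mid suf i j,
  js = pre ++ i :: rcons mid j ++ suf ->
  ~ (aff_word D (i :: rcons mid j) =1 aff_word D mid).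

Lemma exchange_free_infix s1 s2 s3 :
  exchange_free (s1 ++ s2 ++ s3) -> exchange_free s2.
Proof.
move=> ef pre mid suf i j E; apply: (ef (s1 ++ pre) _ (suf ++ s3)).
by rewrite E -!catA /= -!catA.
Qed.

Lemma exchange_free_rev js : exchange_free js -> exchange_free (rev js).
Proof.
move=> ef pre mid suf i j E e; apply: (ef (rev suf) (rev mid) (rev pre) j i).
  by rewrite -[js]revK E !rev_cat rev_cons rev_cat rev_rcons -!cats1 /= -!catA.
have := eq_aff_word_rev e; rewrite rev_cons rev_rcons rcons_cons //.
Qed.

Lemma exchange_free_reduced js :
  (forall s, subseq s js -> aff_word D s =1 aff_word D js -> (size js <= size s)%N) ->
  exchange_free js.
Proof.
move=> red pre mid suf i j E e; have := red (pre ++ mid ++ suf); rewrite E.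
have -> : subseq (pre ++ mid ++ suf) (pre ++ i :: rcons mid j ++ suf).
  apply: cat_subseq => //; apply: subseq_trans (subseq_cons _ _).
  by apply: cat_subseq => //; exact: subseq_rcons.
have -> : (size (pre ++ i :: rcons mid j ++ suf) <= size (pre ++ mid ++ suf))%N = false.
  by rewrite !size_cat /= size_cat size_rcons; lia.
move=> /(_ isT) H; suff : false by [].
apply: H => Z; rewrite -cat_cons !aff_word_cat.
by rewrite e.
Qed.

(** The exchange condition: a root that fails to be positive has changed sign at
    some earlier letter, where it was simple; these two letters cancel. *)
Lemma exchange_free_pos pre j suf : exchange_free (pre ++ j :: suf) ->
  aff_pos (aff_word D pre (asimple j)).
Proof.
elim: pre => [|i pre IH] ef /=; first exact: aff_pos_simple.
have {}IH : aff_pos (aff_word D pre (asimple j)).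
  by apply: IH; apply: (@exchange_free_infix [:: i] _ [::]); rewrite cats0.
apply: aff_pos_refl IH _; first exact/aff_root_word/aff_root_simple.
move=> E; apply: (ef [::] pre suf i j) => [|Z]; first by rewrite cat_rcons.
rewrite aff_word_cons -cats1 aff_word_cat -E aff_word_conj /= aff_reflK //.
exact: aff_simple_root.
Qed.

End Positivity.

(** * Words in the finite Weyl group *)

Section Words.
Context {R : realType} {n : nat} (D : rootData R n) (z : R).
Implicit Types (a b x y : 'cV[R]_n) (v : 'M[R]_n).

Local Notation aff := (Defs.aff (R := R) (n := n)).
Local Notation "(| x , y |)" := (euclid (gram D) x y).
Local Notation pos := (pos_root D).
Local Notation "a ^v" := (coroot D a) (at level 2, format "a ^v").
Local Notation isom := (isom D).
Local Notation asimple := (aff_simple D).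
Local Notation ars := (aff_root_seq D).
Local Notation opp := (@aff_opp R n).
Local Notation fin js := (map (lift ord0) js).

(** The combinatorial content of the theorem for a sequence of roots. *)
Definition cost_bounded e (L : seq aff) := forall v cs, isom v ->
  size cs = size L ->
  \sum_(A <- L) f_cost D z v A.1 <= total D z e v L cs.

Lemma aff_simple_lift i : asimple (lift ord0 i) = (simple D i, 0).
Proof. by rewrite /aff_simple liftK. Qed.

Lemma aff_word_fin js Z : aff_word D (fin js) Z = (word D js *m Z.1, Z.2).
Proof.
elim: js => [|j js IH]; first by rewrite /= mul1mx; case: Z.
rewrite map_cons aff_word_cons IH aff_reflE aff_simple_lift /= mulr0 subr0.
by rewrite mulmxA.
Qed.

(** The finite Weyl group acts on affine roots through the letters other than 0,
    so finite words need no separate treatment. *)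
Lemma root_seq_fin js : root_seq D js = ars (fin js).
Proof.
rewrite /root_seq /aff_root_seq size_map; set F := (X in map X _).
set G := (X in _ = map X _); move: (iota _ _) => s.
suff : forall t, map F (zip s t) = map G (zip s (fin t)) by apply.
elim: s => [|i s IH] [|j t] //=; rewrite IH; congr cons.
by rewrite /F /G /= -map_take aff_word_fin aff_simple_lift.
Qed.

Lemma mulmx_cV_inj (M N : 'M[R]_n) : (forall x, M *m x = N *m x) -> M = N.
Proof.
move=> e; apply/matrixP => i j; have /matrixP /(_ i 0) := e (delta_mx j 0).
by rewrite -!colE !mxE.
Qed.

Lemma reduced_fin js : reduced D (rev js) -> exchange_free D (fin js).
Proof.
move=> red; apply: exchange_free_reduced => s /subseqP[m _ ->].
rewrite -map_mask => e; rewrite !size_map -size_rev -[leqRHS]size_rev.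
apply: red; apply: mulmx_cV_inj => x.
have := eq_aff_word_rev e (x, 0).
by rewrite -!map_rev !aff_word_fin => -[].
Qed.

Lemma reduced_exchange_free js : aff_reduced D (rev js) -> exchange_free D js.
Proof.
move=> red; apply: exchange_free_reduced => s _ /eq_aff_word_rev e.
by rewrite -size_rev -[leqRHS]size_rev; exact: red.
Qed.

Lemma ars_fin2 js : {in ars (fin js), forall A, A.2 = 0}.
Proof.
elim/last_ind: js => // js j IH A; rewrite map_rcons ars_rcons mem_rcons inE.
by case/predU1P => [->|/IH//]; rewrite aff_word_fin aff_simple_lift.
Qed.

Lemma exchange_free_ars js : exchange_free D js ->
  {in ars js, forall A, aff_pos D A}.
Proof.
elim/last_ind: js => // js j IH ef A; rewrite ars_rcons mem_rcons inE.
have ef' : exchange_free D js by apply: (@exchange_free_infix _ _ _ [::] _ [:: j]); rewrite cats1.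
case/predU1P => [->|/(IH ef')//]; apply: (exchange_free_pos (suf := [::])).
by rewrite cats1.
Qed.

Lemma exchange_free_fin_pos js : exchange_free D (fin js) ->
  {in ars (fin js), forall A, pos A.1}.
Proof.
move=> ef A Ain; have := exchange_free_ars ef Ain.
by rewrite /aff_pos (ars_fin2 Ain) ltxx eqxx.
Qed.

Lemma cost_bounded_map (g : aff -> aff) e (y : 'M[R]_n) js : isom y ->
  {in ars js, forall A, pos A.1} ->
  {in ars js, forall A, (g A).1 = y *m A.1 /\ e * (g A).2 = A.2} ->
  cost_bounded e (map g (rev (ars js))).
Proof.
move=> iy p gE v cs iv; rewrite size_map size_rev size_ars => sz.
exact: (total_ge_map z iv iy p sz gE).
Qed.

Lemma isom_word js : isom (word D js).
Proof.
elim: js => [|j js IH]; first exact: isom1.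
exact/isomM/IH/isom_sr/simple_root.
Qed.

Lemma slice_root_seq js r p : (0 < r)%N -> (r <= p)%N -> (p <= size js)%N ->
  slice r p (root_seq D js) =
  map (aff_word D (fin (take r.-1 js))) (ars (fin (drop r.-1 (take p js)))).
Proof.
move=> r0 rp ps; rewrite root_seq_fin -{1}[js](cat_take_drop p).
have sp : size (take p js) = p by exact: size_takel.
have rp' : (r.-1 <= p)%N by lia.
have sr' : size (take r.-1 js) = r.-1 by apply: size_takel; lia.
rewrite -{1}[take p js](cat_take_drop r.-1) take_takel //.
rewrite -catA !map_cat !ars_cat /slice map_cat catA take_size_cat; last first.
  by rewrite size_cat size_map !size_ars !size_map size_drop sr' sp; lia.
by rewrite drop_size_cat // size_ars size_map sr'.
Qed.

(** Each of the four sequences is, up to a linear map, the reversed sequence of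
    roots of the part of the word between r and p or of its reverse, see
    [ars_rev]; the maps are absorbed in [v]. *)
Theorem finite_costs js r p : reduced D (rev js) ->
  (0 < r)%N -> (r <= p)%N -> (p <= size js)%N ->
  let As := slice r p (root_seq D js) in
  [/\ cost_bounded 1 (rev As), cost_bounded 1 (map opp As),
      cost_bounded (-1) As & cost_bounded (-1) (rev (map opp As))].
Proof.
move=> red r0 rp ps As; rewrite /As slice_root_seq //.
set pre := take _ _; set mid := drop _ _.
have ef : exchange_free D (fin mid).
  have := reduced_fin red; rewrite -{1}[js](cat_take_drop p).
  rewrite -{1}[take p js](cat_take_drop r.-1) -catA !map_cat.
  exact: exchange_free_infix.
have efr : exchange_free D (fin (rev mid)).
  by rewrite map_rev; exact: exchange_free_rev.
have pm := exchange_free_fin_pos ef; have pr := exchange_free_fin_pos efr.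
have arsE : ars (fin mid) = map (opp \o aff_word D (fin mid)) (rev (ars (fin (rev mid)))).
  have := ars_rev D (fin (rev mid)); rewrite -map_rev revK => ->.
  by rewrite map_rev.
have iw := isom_word pre; have iw' := isomM iw (isom_word mid).
split.
- rewrite -map_rev; apply: (cost_bounded_map iw pm) => A Ain.
  by rewrite aff_word_fin /= mul1r.
- rewrite arsE -!map_comp; apply: (cost_bounded_map iw' pr) => A Ain.
  rewrite /= !aff_word_fin /aff_opp /= !mulmxN !opprK mulmxA.
  by rewrite (ars_fin2 Ain) mulr0.
- rewrite arsE -map_comp; apply: (cost_bounded_map (isomN iw') pr) => A Ain.
  rewrite /= !aff_word_fin /aff_opp /= mulmxN mulNmx mulmxA.
  by rewrite (ars_fin2 Ain) oppr0 mulr0.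
- rewrite -map_comp -map_rev; apply: (cost_bounded_map (isomN iw) pm) => A Ain.
  by rewrite /= !aff_word_fin /aff_opp /= mulNmx mulrNN mul1r.
Qed.

(** * Words of dominant translations *)

Lemma dominant_pos b a : (forall i, 0 <= (|b, (simple D i)^v|)) -> pos a ->
  0 <= (|b, a|).
Proof.
move=> bd pa; rewrite (coord_sum D a) euclid_sumr sumr_ge0 // => i _.
rewrite euclidZr mulr_ge0 ?(pos_coord _ pa) //.
have := bd i; rewrite corootE euclidZr pmulr_rge0 // invr_gt0.
by rewrite nu_gt0 // simple_root.
Qed.

Lemma hatW_isom h : in_hatW D h -> exists v b, isom v /\
  forall Z, h Z = (v *m Z.1, Z.2 - (|Z.1, b|)).
Proof.
by case=> v [b [[js ->] _ hE]]; exists (word D js), b; split; first exact: isom_word.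
Qed.

Lemma aff_simple_inj : injective asimple.
Proof.
move=> i j; rewrite /aff_simple.
case: unliftP => [k ->|->]; case: unliftP => [l ->|->] // [].
- move=> e; have := coord_simple D k l; rewrite -e coord_simple eqxx.
  by case: eqP => [-> //|_] /eqP; rewrite oner_eq0.
- by move=> _ /esym /eqP; rewrite oner_eq0.
- by move=> _ /eqP; rewrite oner_eq0.
Qed.

(** Elements of Pi permute the simple affine roots, and therefore conjugate a
    word to the word with permuted letters. *)
Lemma Pi_conj h : in_Pi D h -> exists s t : 'I_n.+1 -> 'I_n.+1,
  [/\ cancel s t, cancel t s, injective h, forall i, h (asimple i) = asimple (s i) &
      forall js Z, h (aff_word D js Z) = aff_word D (map s js) (h Z)].
Proof.
case=> /hatW_isom [v [b [iv hE]]] /fin_all_exists [s hs].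
have h_inj : injective h.
  move=> [x c] [y d]; rewrite !hE /= => -[/(isom_inj iv) -> /addIr ->//].
have s_inj : injective s.
  by move=> i j e; apply/aff_simple_inj/h_inj; rewrite !hs e.
have [t st ts] := injF_bij s_inj; exists s, t; split=> // js Z.
elim: js => //= j js <-; rewrite -hs !hE !aff_reflE /= isom_refl // isom_coroot //.
by congr pair; rewrite iv.1 srE euclidBl euclidZl; ring.
Qed.

Lemma exchange_free_Pi h (s t : 'I_n.+1 -> 'I_n.+1) js : cancel s t -> cancel t s ->
  injective h ->
  (forall js Z, h (aff_word D js Z) = aff_word D (map s js) (h Z)) ->
  exchange_free D js -> exchange_free D (map s js).
Proof.
move=> st ts h_inj hw ef pre mid suf i j E e.
apply: (ef (map t pre) (map t mid) (map t suf) (t i) (t j)) => [|Z].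
  by rewrite -[js](mapK st) E map_cat map_cons map_cat map_rcons.
by apply: h_inj; rewrite !hw map_cons map_rcons !(mapK ts) !ts e.
Qed.

(** The translation makes every affine root of the word negative, since the
    opposite of the image is, up to an element of Pi, a root of the reversed
    word. A dominant translation keeps [a, c] positive if a is negative and
    c > 0, so these roots have a positive first component. *)
Lemma dominant_word_pos b h js : in_Pplus D b -> in_Pi D h ->
  transl D b =1 h \o aff_word D (rev js) -> exchange_free D js ->
  {in ars js, forall A, pos A.1}.
Proof.
move=> [_ bd] hPi bE ef A Ain; have rA := ars_root Ain.
have pA := exchange_free_ars ef Ain.
have [B pB BE] : exists2 B, aff_pos D B & transl D b A = aff_opp B.
  have [s [t [st ts h_inj hs hw]]] := Pi_conj hPi.
  have /hatW_isom[v [c [iv hE]]] := hPi.1.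
  have: A \in map (opp \o aff_word D js) (rev (ars (rev js))).
    by rewrite map_rev -[X in map (_ \o aff_word D X)]revK -ars_rev revK.
  case/mapP => C Cin AE; exists (h C); last first.
    rewrite AE bE /= aff_wordN aff_word_revK.
    by rewrite !hE /aff_opp /= mulmxN euclidNl; congr pair; ring.
  have : h C \in ars (map s (rev js)).
    rewrite mem_rev in Cin; move: Cin; move: (rev js) => us.
    elim/last_ind: us => // us j IH; rewrite map_rcons !ars_rcons !mem_rcons !inE.
    case/predU1P=> [->|/IH ->]; last by rewrite orbT.
    by rewrite hw hs eqxx.
  apply: exchange_free_ars; apply: exchange_free_Pi hw _ => //.
  exact: exchange_free_rev.
apply/negPn/negP => npA; have A2 : 0 < A.2.
  by move: pA; rewrite /aff_pos (negbTE npA) andbF orbF.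
have bA : 0 <= (|b, - A.1|) by apply: dominant_pos => //; rewrite posN.
have : (transl D b A).2 <= 0.
  rewrite BE /= oppr_le0; move: pB.
  by case/orP=> [/ltW //|/andP[/eqP -> _]].
by rewrite /= (euclidC D A.1); move: bA; rewrite euclidNr; lra.
Qed.

Theorem dominant_costs b h js p : in_Pplus D b -> in_Pi D h ->
  transl D b =1 h \o aff_word D (rev js) -> aff_reduced D (rev js) ->
  (p <= size js)%N ->
  let As := slice 1 p (aff_root_seq D js) in
  cost_bounded 1 (rev As) /\ cost_bounded (-1) (rev (map opp As)).
Proof.
move=> bd hPi bE red ps As.
have pj := dominant_word_pos bd hPi bE (reduced_exchange_free red).
have AsE : As = ars (take p js).
  rewrite /As /slice drop0 -{1}[js](cat_take_drop p) ars_cat take_size_cat //.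
  by rewrite size_ars size_takel.
have pos_p : {in ars (take p js), forall A, pos A.1}.
  move=> A Ain; apply: pj; rewrite -[js](cat_take_drop p) ars_cat mem_cat.
  by rewrite Ain.
rewrite AsE; split.
  rewrite -[rev _]map_id; apply: (cost_bounded_map (isom1 D) pos_p) => A _.
  by rewrite mul1mx mul1r.
rewrite -map_rev; apply: (cost_bounded_map (isom_opp1 D) pos_p) => A _.
by rewrite /= mulNmx mul1mx mulrNN mul1r.
Qed.

End Words.

(** * Orders of multivariate polynomials in one variable *)

Section PolyOrder.
Context {N : nat} {k : fieldType} (i : 'I_N).
Local Notation Pol := (mpoly N k).
Implicit Types (p q : Pol) (e : multinom N).

(** The default value [msize p] exceeds all exponents of [p]. *)
Definition mpord p : nat := \big[minn/msize p]_(e <- msupp p) e i.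

Lemma mpord_le p e : e \in msupp p -> (mpord p <= e i)%N.
Proof.
rewrite /mpord; elim: (msupp p) => // d s IH; rewrite inE big_cons geq_min.
by case/predU1P=> [->|/IH ->]; rewrite ?leqnn ?orbT.
Qed.

Lemma mpord_ge p m : p != 0 -> (forall e, e \in msupp p -> (m <= e i)%N) ->
  (m <= mpord p)%N.
Proof.
move=> p0 H; have mp : (m <= msize p)%N.
  case E : (msupp p) => [|e s]; first by rewrite -msupp_eq0 E in p0.
  have ep : e \in msupp p by rewrite E mem_head.
  apply: leq_trans (H _ ep) (leq_trans _ (ltnW (msize_mdeg_lt ep))).
  by rewrite mdegE (bigD1 i) //= leq_addr.
rewrite /mpord big_seq; apply: (big_ind (fun x => m <= x)%N) => // x y.
by rewrite leq_min => -> ->.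
Qed.

Lemma mpordP p : p != 0 -> exists2 e, e \in msupp p & mpord p = e i.
Proof.
move=> p0; have [/hasP[e ep /eqP <-]|/hasPn H] := boolP (has (fun e => e i == mpord p) (msupp p)).
  by exists e.
suff : (mpord p < mpord p)%N by rewrite ltnn.
apply: mpord_ge => // e ep.
by rewrite ltn_neqAle mpord_le // eq_sym H.
Qed.

Definition low p : Pol := \sum_(e <- msupp p | e i == mpord p) mcoeff e p *: mpolyX k e.

Lemma mcoeff_low p e : mcoeff e (low p) = mcoeff e p *+ (e i == mpord p).
Proof.
rewrite /low raddf_sum /=; under eq_bigr => d _ do rewrite mcoeffZ mcoeffX.
have [ep|] := boolP (e \in msupp p).
  rewrite big_mkcond (bigD1_seq e) ?msupp_uniq //= eqxx mulr1 big1 ?addr0.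
    by case: eqP.
  by move=> d /negbTE ->; rewrite mulr0 if_same.
rewrite mcoeff_msupp negbK => /eqP e0; rewrite e0 mul0rn big1 // => d _.
by case: eqP => [->|_]; rewrite ?e0 ?mul0r ?mulr0.
Qed.

(** The product of the lowest parts does not vanish in an integral domain, and
    all other products have larger exponents. *)
Lemma mpordM p q : p != 0 -> q != 0 -> mpord (p * q) = (mpord p + mpord q)%N.
Proof.
move=> p0 q0; have pq0 : p * q != 0 by rewrite mulf_neq0.
have suppM (u v : Pol) a b : (forall e, e \in msupp u -> (a <= e i)%N) ->
    (forall e, e \in msupp v -> (b <= e i)%N) ->
    forall e, e \in msupp (u * v) -> (a + b <= e i)%N.
  move=> ua vb e /msuppM_le /allpairsP[[e1 e2] /= [/ua h1 /vb h2 ->]].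
  by rewrite mnmDE leq_add.
apply/eqP; rewrite eqn_leq; apply/andP; split; last first.
  by apply: mpord_ge => // e; apply: suppM => ? /mpord_le.
have low0 u : u != 0 -> low u != 0.
  move=> /mpordP[e eu E]; apply/negP => /eqP /(congr1 (mcoeff e)).
  by rewrite mcoeff_low -E eqxx mcoeff0; apply/eqP; rewrite -mcoeff_msupp.
have hi u e : e \in msupp (u - low u) -> ((mpord u).+1 <= e i)%N.
  rewrite mcoeff_msupp mcoeffB mcoeff_low => H; rewrite ltn_neqAle eq_sym.
  have [E|ne] := eqVneq (e i) (mpord u); first by rewrite E eqxx subrr eqxx in H.
  by apply: mpord_le; rewrite mcoeff_msupp; rewrite (negbTE ne) subr0 in H.
have lowE u e : e \in msupp (low u) -> e i = mpord u.
  by rewrite mcoeff_msupp mcoeff_low; have [//|_] := eqVneq (e i) (mpord u); rewrite mulr0n eqxx.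
have le u e : e \in msupp (low u) -> (mpord u <= e i)%N by move=> /lowE ->.
have [e elow] : exists e, e \in msupp (low p * low q).
  have := mulf_neq0 (low0 p p0) (low0 q q0); rewrite -msupp_eq0.
  by case: (msupp _) => // e s _; exists e; rewrite mem_head.
have ei : e i = (mpord p + mpord q)%N.
  move: elow => /msuppM_le /allpairsP[[e1 e2] /= [/lowE h1 /lowE h2 ->]].
  by rewrite mnmDE h1 h2.
rewrite -ei; apply: mpord_le; rewrite mcoeff_msupp.
have -> : p * q = low p * low q + ((p - low p) * q + low p * (q - low q)) by ring.
rewrite mcoeffD; have -> : mcoeff e ((p - low p) * q + low p * (q - low q)) = 0.
  apply/eqP; rewrite -[_ == 0]negbK -mcoeff_msupp; apply/negP => /msuppD_le.
  rewrite mem_cat => /orP[].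
    move=> /(suppM _ _ _ _ (hi p) (@mpord_le q)); lia.
  move=> /(suppM _ _ _ _ (le p) (hi q)); lia.
by rewrite addr0 -mcoeff_msupp.
Qed.

Lemma mpordX e : mpord (mpolyX k e) = e i.
Proof.
have [|d] := mpordP (p := mpolyX k e); first by rewrite -msupp_eq0 msuppX.
by rewrite msuppX inE => /eqP ->.
Qed.

End PolyOrder.

Lemma num_den (R : idomainType) (f : {fraction R}) :
  f = tofrac (frac (repr f)).1 / tofrac (frac (repr f)).2.
Proof.
rewrite -[LHS]reprK; have d0 := denom_ratioP (repr f).
unlock tofrac; rewrite -[_^-1]FracField.pi_inv -[RHS]FracField.pi_mul.
rewrite /FracField.mulf /FracField.invf !(numden_Ratio, oner_neq0) // mulr1 mul1r.
by rewrite Ratio_numden.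
Qed.

(** * Orders of fractions and Laurent monomials *)

Section LaurentMonomials.
Context {N : nat} {k : fieldType}.
Local Notation Pol := (mpoly N k).
Local Notation F := {fraction Pol}.
Local Notation "x %:F" := (tofrac x).
Implicit Types (p q : Pol) (f g : F) (u : 'rV[int]_N).

Local Notation num f := (frac (repr f)).1.
Local Notation den f := (frac (repr f)).2.

Lemma den_neq0 f : den f != 0. Proof. exact: denom_ratioP. Qed.

Lemma num_neq0 f : f != 0 -> num f != 0.
Proof.
by apply: contraNneq => n0; rewrite (num_den f) n0 rmorph0 mul0r.
Qed.

(** The representative of a fraction need not be the given one, but the two have
    equal cross products; this is all that is used about representatives. *)
Lemma num_den_cross p q : q != 0 ->
  num (p%:F / q%:F) * q = p * den (p%:F / q%:F).
Proof.
move=> q0; set f := _ / _; have d0 := den_neq0 f.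
apply/eqP; rewrite -tofrac_eq !rmorphM /=; apply/eqP.
have := num_den f; rewrite {1}/f => /eqP; rewrite eqr_div ?tofrac_eq0 //.
by move=> /eqP ->; rewrite mulrC.
Qed.

Definition fval i f : int := (mpord i (num f))%:Z - (mpord i (den f))%:Z.

Lemma fval_frac i p q : p != 0 -> q != 0 ->
  fval i (p%:F / q%:F) = (mpord i p)%:Z - (mpord i q)%:Z.
Proof.
move=> p0 q0; set f := _ / _.
have f0 : f != 0 by rewrite mulf_neq0 ?invr_eq0 ?tofrac_eq0.
have n0 := num_neq0 f0; have d0 := den_neq0 f.
have := num_den_cross p q0; rewrite -/f.
move=> /(congr1 (mpord i)); rewrite !mpordM // /fval.
move: (mpord _ _) (mpord _ _) (mpord _ _) (mpord _ _) => a b c d; clear; lia.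
Qed.

Lemma fvalM i f g : f != 0 -> g != 0 -> fval i (f * g) = fval i f + fval i g.
Proof.
move=> f0 g0; rewrite {1}(num_den f) {1}(num_den g) mulf_div -!rmorphM.
have [n1 n2] := (num_neq0 f0, num_neq0 g0); have [d1 d2] := (den_neq0 f, den_neq0 g).
by rewrite fval_frac ?mulf_neq0 // !mpordM // /fval !PoszD opprD addrACA.
Qed.

Lemma fval1 i : fval i 1 = 0.
Proof. by have := @fvalM i 1 1 (oner_neq0 _) (oner_neq0 _); rewrite mulr1; lia. Qed.

Lemma fvalN i f : f != 0 -> fval i (- f) = fval i f.
Proof.
move=> f0; have m1 : -1 != 0 :> F by rewrite oppr_eq0 oner_eq0.
have m10 : fval i (-1) = 0.
  have := fvalM i m1 m1; rewrite mulrNN mulr1 fval1.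
  by move: (fval _ _) => c; clear; lia.
by rewrite -mulN1r (fvalM i m1 f0) m10 add0r.
Qed.

Lemma fvalV i f : f != 0 -> fval i f^-1 = - fval i f.
Proof.
move=> f0; have := @fvalM i f f^-1 f0; rewrite invr_eq0 => /(_ f0).
by rewrite mulfV // fval1; lia.
Qed.

Lemma fval_div i f g : f != 0 -> g != 0 ->
  f / g != 0 /\ fval i (f / g) = fval i f - fval i g.
Proof.
move=> f0 g0; have gV0 : g^-1 != 0 by rewrite invr_eq0.
by split; [exact: (mulf_neq0 f0 gV0) | rewrite (fvalM i f0 gV0) (fvalV i g0)].
Qed.

Definition mvar i : F := (mpolyX k (mnm1 i))%:F.

Lemma mvar_neq0 i : mvar i != 0.
Proof. by rewrite tofrac_eq0 -msupp_eq0 msuppX. Qed.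

Definition mon u : F := \prod_i mvar i ^ u 0 i.

Lemma mon_neq0 u : mon u != 0.
Proof. by apply/prodf_neq0 => i _; rewrite expfz_neq0 ?mvar_neq0. Qed.

Lemma monD u v : mon (u + v) = mon u * mon v.
Proof.
rewrite /mon -big_split /=; apply: eq_bigr => i _.
by rewrite mxE expfzDr ?mvar_neq0.
Qed.

Lemma mon0 : mon 0 = 1.
Proof. by rewrite /mon big1 // => i _; rewrite mxE expr0z. Qed.

Lemma monN u : mon (- u) = (mon u)^-1.
Proof. by apply: (mulIf (mon_neq0 u)); rewrite -monD addNr mon0 mulVf ?mon_neq0. Qed.

Lemma monZ c u : mon (c *: u) = mon u ^ c.
Proof.
rewrite (big_morph (fun x : F => x ^ c) (fun x y => expfzMl x y c) (exp1rz _ c)).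
by apply: eq_bigr => i _; rewrite mxE mulrC exprz_exp.
Qed.

Lemma mon_sum (I : Type) (r : seq I) (G : I -> 'rV[int]_N) :
  mon (\sum_(j <- r) G j) = \prod_(j <- r) mon (G j).
Proof. exact: (big_morph mon monD mon0). Qed.

Lemma mon_delta i : mon (delta_mx 0 i) = mvar i.
Proof.
rewrite /mon (bigD1 i) //= mxE !eqxx expr1z big1 ?mulr1 // => j ji.
by rewrite mxE (negbTE ji) expr0z.
Qed.

Lemma fval_tofrac i p : p != 0 -> fval i p%:F = mpord i p.
Proof.
move=> p0; have := @fval_frac i p 1 p0 (oner_neq0 _); rewrite rmorph1 divr1 => ->.
have := @mpordM _ _ i 1 1 (oner_neq0 Pol) (oner_neq0 Pol); rewrite mulr1; lia.
Qed.

Definition row_mnm (e : multinom N) : 'rV[int]_N := \row_i (e i)%:Z.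

Lemma mpolyX_neq0 e : mpolyX k e != 0 :> Pol.
Proof. by rewrite -msupp_eq0 msuppX. Qed.

Lemma tofracX e : (mpolyX k e)%:F = mon (row_mnm e).
Proof.
have -> : mpolyX k e = \prod_i mpolyX k (mnm1 i) ^+ e i.
  exact: mpolyXE_id.
by rewrite rmorph_prod; apply: eq_bigr => i _; rewrite rmorphXn mxE.
Qed.

Definition pos_mnm u : multinom N := Multinom [tuple if 0 <= u 0 i then absz (u 0 i) else 0%N | i < N].
Definition neg_mnm u : multinom N := Multinom [tuple if 0 <= u 0 i then 0%N else absz (u 0 i) | i < N].

Lemma row_pos_neg u : row_mnm (pos_mnm u) - row_mnm (neg_mnm u) = u.
Proof.
apply/rowP => i; rewrite !mxE !mnmE; case: (u 0 i) => c /=; first exact: subr0.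
by rewrite sub0r NegzE.
Qed.

Lemma mon_tofrac u : mon u * (mpolyX k (neg_mnm u))%:F = (mpolyX k (pos_mnm u))%:F.
Proof. by rewrite !tofracX -{1}(row_pos_neg u) monD monN mulfVK ?mon_neq0. Qed.

Lemma fval_mon i u : fval i (mon u) = u 0 i.
Proof.
have := mon_tofrac u => /(congr1 (fval i)).
rewrite fvalM ?mon_neq0 ?tofrac_eq0 ?mpolyX_neq0 // !fval_tofrac ?mpolyX_neq0 //.
by rewrite !mpordX !mnmE; case: ifP; lia.
Qed.

(** A nontrivial monomial differs from 1, so no cancellation lowers the exponents
    of its numerator and denominator. *)
Lemma mon_sub1 i u : u != 0 ->
  mon u - 1 != 0 /\ fval i (mon u - 1) = Num.min (u 0 i) 0.
Proof.
move=> u0; set p := mpolyX k (pos_mnm u); set q := mpolyX k (neg_mnm u).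
have ne : pos_mnm u != neg_mnm u.
  by apply: contraNneq u0 => e; rewrite -(row_pos_neg u) e subrr.
have supp e : e \in msupp (p - q) = (e \in [:: pos_mnm u; neg_mnm u]).
  rewrite mcoeff_msupp mcoeffB !mcoeffX !inE ![_ == e]eq_sym.
  have [->|_] := eqVneq e (pos_mnm u); first by rewrite (negbTE ne) subr0 oner_eq0.
  by have [_|_] := eqVneq e (neg_mnm u); rewrite ?subrr ?eqxx // sub0r oppr_eq0 oner_eq0.
have pq0 : p - q != 0.
  by rewrite -msupp_eq0; have := supp (pos_mnm u); rewrite !inE eqxx; case: (msupp _).
have E : mon u - 1 = (p - q)%:F / q%:F.
  apply: (mulIf (x := q%:F)); first by rewrite tofrac_eq0 mpolyX_neq0.
  rewrite mulfVK ?tofrac_eq0 ?mpolyX_neq0 // mulrBl mul1r mon_tofrac.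
  by rewrite rmorphB.
rewrite E mulf_neq0 ?invr_eq0 ?tofrac_eq0 ?mpolyX_neq0 //; split=> //.
rewrite fval_frac ?mpolyX_neq0 // mpordX.
have le1 : (mpord i (p - q)%R <= pos_mnm u i)%N by apply: mpord_le; rewrite supp !inE eqxx.
have le2 : (mpord i (p - q)%R <= neg_mnm u i)%N by apply: mpord_le; rewrite supp !inE eqxx orbT.
move: le1 le2; rewrite !mnmE /Num.min; case: ifP; case: ifP; lia.
Qed.

(** * Monomial substitutions *)

Section Substitution.
Variable h : 'I_N -> F.

Definition ev p : F := mmap (@tofrac _ \o @mpolyC N k) h p.
HB.instance Definition _ := GRing.RMorphism.copy ev (mmap (@tofrac _ \o @mpolyC N k) h).

(** A substitution is evaluated on representatives of fractions; it is well
    defined as soon as it is injective on polynomials. *)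
Definition fsubst f : F := ev (num f) / ev (den f).

Hypothesis ev_inj : forall p, ev p = 0 -> p = 0.

Lemma ev_neq0 p : p != 0 -> ev p != 0.
Proof. by apply: contraNneq => /ev_inj ->. Qed.

Lemma fsubst_frac p q : q != 0 -> fsubst (p%:F / q%:F) = ev p / ev q.
Proof.
move=> q0; set f := _ / _; have d0 := den_neq0 f.
rewrite /fsubst; apply/eqP; rewrite eqr_div ?ev_neq0 // -!rmorphM; apply/eqP.
congr ev; exact: num_den_cross.
Qed.

Lemma fsubst_tofrac p : fsubst p%:F = ev p.
Proof.
by have := fsubst_frac p (oner_neq0 _); rewrite !rmorph1 !divr1.
Qed.

Lemma fsubstM f g : fsubst (f * g) = fsubst f * fsubst g.
Proof.
rewrite {1}(num_den f) {1}(num_den g) mulf_div -!rmorphM fsubst_frac.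
  by rewrite !rmorphM /fsubst mulf_div.
by rewrite mulf_neq0 ?den_neq0.
Qed.

Lemma fsubstB f g : fsubst (f - g) = fsubst f - fsubst g.
Proof.
have d1 := den_neq0 f; have d2 := den_neq0 g.
rewrite {1}(num_den f) {1}(num_den g) -mulNr addf_div ?tofrac_eq0 //.
rewrite -rmorphN -!rmorphM -rmorphD fsubst_frac ?mulf_neq0 //.
by rewrite rmorphD !rmorphM rmorphN /fsubst -addf_div ?ev_neq0 // mulNr.
Qed.

Lemma fsubst_rmorphism : {phi : {rmorphism F -> F} | phi =1 fsubst}.
Proof.
have a : zmod_morphism fsubst by exact: fsubstB.
have m : monoid_morphism fsubst.
  by split; [have := fsubst_tofrac 1; rewrite !rmorph1|exact: fsubstM].
pose A := GRing.isZmodMorphism.Build F F fsubst a.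
pose M := GRing.isMonoidMorphism.Build F F fsubst m.
pose phi : {rmorphism F -> F} := HB.pack fsubst A M.
by exists phi.
Qed.

End Substitution.

(** The monomial substitution given by an integer matrix of exponents; on the
    exponents of monomials it acts by multiplication with the matrix. *)
Definition mx_image (E : 'M[int]_N) (j : 'I_N) : F := mon (row j E).

Lemma mon_mulmx u E : mon (u *m E) = \prod_j mx_image E j ^ u 0 j.
Proof. by rewrite mulmx_sum_row mon_sum; apply: eq_bigr => j _; rewrite monZ. Qed.

Lemma ev_mx E e : ev (mx_image E) (mpolyX k e) = mon (row_mnm e *m E).
Proof.
rewrite /ev mmapX mon_mulmx /mmap1; apply: eq_bigr => j _.
by rewrite mxE.
Qed.

Lemma evC h c : ev h (mpolyC N c) = (mpolyC N c)%:F.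
Proof. by rewrite /ev mmapC. Qed.

(** Up to a monomial denominator the values are polynomials, from which the
    inverse substitution recovers the argument. *)
Lemma ev_mx_inj E E' : E *m E' = 1%:M -> forall p, ev (mx_image E) p = 0 -> p = 0.
Proof.
move=> EE' p p0; set f := ev (mx_image E) in p0; set f' := ev (mx_image E').
have f'X e : f' (mpolyX k e) != 0 by rewrite /f' ev_mx mon_neq0.
suff [e [q [fq f'q]]] : exists e q,
    f p * (mpolyX k e)%:F = q%:F /\ f' q = p%:F * f' (mpolyX k e).
  have q0 : q = 0 by apply/eqP; rewrite -tofrac_eq0 -fq p0 mul0r.
  move: f'q; rewrite q0 /f' rmorph0 => /esym/eqP; rewrite mulf_eq0 tofrac_eq0.
  by rewrite -/f' (negbTE (f'X e)) orbF => /eqP.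
elim/mpolyind: p {p0} => [|c e p _ _ [d [q [fq f'q]]]].
  by exists mnm0, 0; rewrite /f /f' !rmorph0 !mul0r.
set u := row_mnm e *m E.
exists (mnm_add d (neg_mnm u)),
  (mpolyC N c * mpolyX k (pos_mnm u) * mpolyX k d + q * mpolyX k (neg_mnm u)).
rewrite -mul_mpolyC /f /f' !rmorphD !rmorphM /= !mpolyXD !rmorphM /= !evC.
rewrite -/f -/f' f'q; split.
  rewrite mulrDl -fq /f ev_mx -/u -mon_tofrac; ring.
have -> : f' (mpolyX k (pos_mnm u)) = (mpolyX k e)%:F * f' (mpolyX k (neg_mnm u)).
  rewrite /f' !ev_mx tofracX -monD; congr mon.
  have -> : row_mnm (pos_mnm u) = u + row_mnm (neg_mnm u).
    by apply/eqP; rewrite -subr_eq row_pos_neg.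
  by rewrite mulmxDl -mulmxA EE' mulmx1.
ring.
Qed.

Section MatrixSubstitution.
Variables E E' : 'M[int]_N.
Hypothesis EE' : E *m E' = 1%:M.
Local Notation sb := (fsubst (mx_image E)).

Lemma fsubst_mx_rmorphism : {phi : {rmorphism F -> F} | phi =1 sb}.
Proof. exact: fsubst_rmorphism (ev_mx_inj EE'). Qed.

Lemma fsubst_mx_mon u : sb (mon u) = mon (u *m E).
Proof.
case: fsubst_mx_rmorphism => phi phiE; rewrite -phiE rmorph_prod mon_mulmx.
apply: eq_bigr => j _; rewrite fmorphXz phiE fsubst_tofrac; last exact: ev_mx_inj EE'.
rewrite ev_mx mon_mulmx; congr (_ ^ _).
rewrite (bigD1 j) //= mxE mnm1E eqxx expr1z big1 ?mulr1 // => l lj.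
by rewrite mxE mnm1E eq_sym (negbTE lj) expr0z.
Qed.

Lemma fsubst_mxM f g : sb (f * g) = sb f * sb g.
Proof. by case: fsubst_mx_rmorphism => phi phiE; rewrite -!phiE rmorphM. Qed.

Lemma fsubst_mxB f g : sb (f - g) = sb f - sb g.
Proof. by case: fsubst_mx_rmorphism => phi phiE; rewrite -!phiE rmorphB. Qed.

Lemma fsubst_mxN f : sb (- f) = - sb f.
Proof. by case: fsubst_mx_rmorphism => phi phiE; rewrite -!phiE rmorphN. Qed.

Lemma fsubst_mxV f : sb f^-1 = (sb f)^-1.
Proof. by case: fsubst_mx_rmorphism => phi phiE; rewrite -!phiE fmorphV. Qed.

Lemma fsubst_mx1 : sb 1 = 1.
Proof. by case: fsubst_mx_rmorphism => phi phiE; rewrite -!phiE rmorph1. Qed.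

Lemma fsubst_mx_eq0 f : (sb f == 0) = (f == 0).
Proof. by case: fsubst_mx_rmorphism => phi phiE; rewrite -!phiE fmorph_eq0. Qed.

End MatrixSubstitution.

End LaurentMonomials.

(** * The Weyl group and the weight lattice *)

Section Lattice.
Context {R : realType} {n : nat} (D : rootData R n).
Implicit Types (a b x y : 'cV[R]_n) (v w : 'M[R]_n).

Local Notation "(| x , y |)" := (euclid (gram D) x y).
Local Notation rt := (Defs.roots D).
Local Notation sr a := (Defs.refl (gram D) a).
Local Notation pos := (pos_root D).
Local Notation "a ^v" := (coroot D a) (at level 2, format "a ^v").
Local Notation isom := (isom D).
Local Notation in_P := (in_P D).
Local Notation in_W := (in_W D).
Local Notation word := (Defs.word D).

Lemma word_cat s1 s2 : word (s1 ++ s2) = word s1 *m word s2.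
Proof. by elim: s1 => [|i s1 IH] /=; rewrite ?mul1mx // IH mulmxA. Qed.

Lemma in_W1 : in_W 1%:M. Proof. by exists [::]. Qed.

Lemma in_WM v w : in_W v -> in_W w -> in_W (v *m w).
Proof. by move=> [s ->] [t ->]; exists (s ++ t); rewrite word_cat. Qed.

Lemma in_W_isom v : in_W v -> isom v.
Proof. by case=> s ->; exact: isom_word. Qed.

Lemma word_revK s : word (rev s) *m word s = 1%:M.
Proof.
elim: s => [|i s IH] /=; first by rewrite mul1mx.
rewrite rev_cons -cats1 word_cat /= mulmx1 -mulmxA (mulmxA (sr _)).
by rewrite sr_sq ?mul1mx // simple_root.
Qed.

Lemma in_WV v : in_W v -> in_W (invmx v).
Proof.
case=> s ->; exists (rev s); have iw := isom_unit (isom_word D s).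
by rewrite -[LHS]mul1mx -(word_revK s) mulmxK.
Qed.

(** Induction on the height: a positive root that is not simple has a positive
    pairing with some simple root, whose reflection lowers its height. *)
Lemma root_conj a : pos a -> exists s i, a = word s *m simple D i.
Proof.
move=> pa; have [N] : exists N, \sum_i coord D a i < N%:R.
  exists (Num.bound (\sum_i coord D a i)); apply: archi_boundP.
  by rewrite sumr_ge0 // => i _; exact: pos_coord pa.
elim: N a pa => [|N IH] a pa lt1.
  move: lt1; rewrite ltNge sumr_ge0 // => i _; exact: pos_coord pa.
have ra := pos_mem pa.
have [i ai] : exists i, 0 < (|a, simple D i|).
  have [/existsP//|] := boolP [exists i, 0 < (|a, simple D i|)].
  rewrite negb_exists => /forallP H; have := norm_gt0 ra.
  rewrite {2}(coord_sum D a) euclid_sumr ltNge sumr_le0 // => i _.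
  by rewrite euclidZr mulr_ge0_le0 ?(pos_coord i pa) // leNgt.
have ri := simple_root D i.
have [->|ne] := eqVneq a (simple D i); first by exists [::], i; rewrite mul1mx.
have [s [j E]] : exists s j, sr (simple D i) *m a = word s *m simple D j.
  apply: IH; first exact: pos_sr_simple.
  have [c cE] := root_pairing_int ri ra.
  have c1 : 1 <= (|a, (simple D i)^v|).
    have : 0 < (|a, (simple D i)^v|).
      by rewrite corootE euclidZr mulr_gt0 ?invr_gt0 ?nu_gt0.
    by rewrite cE ltr0z -[1]/(1%:~R) ler_int; lia.
  rewrite srE; under eq_bigr => l _ do rewrite coordB coordZ coord_simple.
  have -> : \sum_l (coord D a l - (|a, (simple D i)^v|) * (l == i)%:R) =
      \sum_l coord D a l - (|a, (simple D i)^v|).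
    rewrite sumrB -mulr_sumr; congr (_ - _); rewrite -[RHS]mulr1; congr (_ * _).
    by rewrite (bigD1 i) //= eqxx big1 ?addr0 // => l /negbTE ->.
  by move: lt1; rewrite -natr1; lra.
exists (i :: s), j; rewrite /= -mulmxA -E srK //.
Qed.

Lemma in_W_sr a : a \in rt -> in_W (sr a).
Proof.
have P b : pos b -> in_W (sr b).
  move=> /root_conj[s [i ->]]; exists (s ++ i :: rev s).
  rewrite word_cat /= mulmxA -(isom_sr_comm _ (isom_word D s)).
  have := word_revK (rev s); rewrite revK -mulmxA => ->.
  by rewrite mulmx1.
move=> ra; have [/P//|] := boolP (pos a); rewrite -posN // => /P.
by rewrite srN.
Qed.

Lemma in_PD x y : in_P x -> in_P y -> in_P (x + y).
Proof. by move=> px py i; rewrite euclidDl rpredD. Qed.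

Lemma in_PZ (c : int) x : in_P x -> in_P (c%:~R *: x).
Proof. by move=> px i; rewrite euclidZl rpredM // intr_int. Qed.

Lemma in_P0 : in_P 0.
Proof. by move=> i; rewrite euclid0l rpred0. Qed.

Lemma in_P_root a : a \in rt -> in_P a.
Proof. by move=> ra i; apply: roots_int => //; exact: simple_root. Qed.

Lemma in_P_word s x : in_P x -> in_P (word s *m x).
Proof.
elim: s => [|i s IH] px /=; first by rewrite mul1mx.
move=> j; rewrite -mulmxA srE euclidBl euclidZl rpredB ?IH // rpredM ?IH //.
exact/in_P_root/simple_root.
Qed.

Lemma in_P_W v x : in_W v -> in_P x -> in_P (v *m x).
Proof. by case=> s ->; exact: in_P_word. Qed.

(** Every coroot is conjugate to a simple coroot up to sign, and P is invariant. *)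
Lemma in_P_coroot x a : in_P x -> a \in rt -> (|x, a^v|) \is a Num.int.
Proof.
have P b : in_P x -> pos b -> (|x, b^v|) \is a Num.int.
  move=> px /root_conj[s [i ->]]; have iw := isom_word D s.
  rewrite isom_coroot // -[x](mulKVmx (isom_unit iw)) iw.1.
  by apply: in_P_W => //; apply: in_WV; exists s.
move=> px ra; have [/(P _ px)//|] := boolP (pos a).
by rewrite -posN // => /(P _ px); rewrite corootN euclidNr rpredN.
Qed.

Lemma coroot_mx_unit : coroot_mx D \in unitmx.
Proof.
have -> : coroot_mx D = simple_mx D *m diag_mx (\row_j (nu D (simple D j))^-1).
  by apply/matrixP => i j; rewrite mul_mx_diag [LHS]mxE corootE !mxE mulrC.
rewrite unitmx_mul simple_mx_unit unitmxE det_diag unitfE.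
by apply/prodf_neq0 => i _; rewrite mxE invr_eq0 nu_neq0 // simple_root.
Qed.

Lemma fund_weightE i j : (|fund_weight D i, (simple D j)^v|) = (i == j)%:R.
Proof.
have gu : gram D *m coroot_mx D \in unitmx.
  by rewrite unitmx_mul gram_unit coroot_mx_unit.
rewrite /euclid /fund_weight trmxK.
have -> : (simple D j)^v = coroot_mx D *m delta_mx j 0.
  by rewrite -colE; apply/colP => l; rewrite !mxE.
rewrite rowE -!mulmxA (mulmxA (gram D)) mulKmx // -rowE !mxE eqxx andbT.
by rewrite eq_sym.
Qed.

Lemma in_P_fund i : in_P (fund_weight D i).
Proof. by move=> j; rewrite fund_weightE -[_%:R]/((i == j)%:Z%:~R) intr_int. Qed.

(** The coordinates in the basis of fundamental weights, for elements of P. *)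
Definition weight b : 'rV[int]_n := \row_i Num.floor (|b, (simple D i)^v|).

Lemma weightE b i : in_P b -> (weight b 0 i)%:~R = (|b, (simple D i)^v|) :> R.
Proof. by move=> /(_ i) bi; rewrite mxE floorK. Qed.

Lemma weight_sum b : in_P b -> b = \sum_i (weight b 0 i)%:~R *: fund_weight D i.
Proof.
move=> pb; set c := (X in _ = X).
have e j : (|b - c, (simple D j)^v|) = 0.
  rewrite euclidBl /c euclid_suml (bigD1 j) //= big1 => [|i ij].
    by rewrite euclidZl fund_weightE eqxx mulr1 addr0 weightE // subrr.
  by rewrite euclidZl fund_weightE (negbTE ij) mulr0.
apply/eqP; rewrite -subr_eq0; apply/negPn/negP => /(gram_pos D).
rewrite {2}(coord_sum D (b - c)) euclid_sumr big1 ?ltxx // => j _.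
rewrite -[simple D j](scalerK (invr_neq0 (nu_neq0 (simple_root D j)))) -corootE.
by rewrite euclidZr euclidZr e !mulr0.
Qed.

Lemma weight_fund i : weight (fund_weight D i) = delta_mx 0 i.
Proof.
apply/rowP => j; apply: (intr_inj (R := R)); rewrite weightE; last exact: in_P_fund.
by rewrite fund_weightE mxE eqxx /= eq_sym; case: eqP.
Qed.

Definition weight_mx v : 'M[int]_n := \matrix_(i, j) weight (v *m fund_weight D i) 0 j.

Lemma row_weight_mx v i : row i (weight_mx v) = weight (v *m fund_weight D i).
Proof. by apply/rowP => j; rewrite !mxE. Qed.

(** Evaluates integer combinations with the coordinates of b as coefficients:
    linear functions on P are determined by the fundamental weights. *)
Lemma weight_linear b (phi : 'cV[R]_n -> R) (psi : 'I_n -> int) : in_P b ->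
  (forall x y, phi (x + y) = phi x + phi y) -> (forall c x, phi (c *: x) = c * phi x) ->
  (forall i, (psi i)%:~R = phi (fund_weight D i)) ->
  (\sum_i weight b 0 i * psi i)%:~R = phi b.
Proof.
move=> pb phiD phiZ psiE; rewrite {2}(weight_sum pb) rmorph_sum /=.
have phi0 : phi 0 = 0 by rewrite -(scale0r 0) phiZ mul0r.
rewrite (big_morph phi phiD phi0); apply: eq_bigr => i _.
by rewrite rmorphM /= phiZ psiE.
Qed.

Lemma weight_W b v : in_P b -> in_W v -> weight b *m weight_mx v = weight (v *m b).
Proof.
move=> pb wv; apply/rowP => j; apply: (intr_inj (R := R)).
rewrite weightE; last exact: in_P_W.
rewrite mxE; apply: (weight_linear pb (phi := fun x => (|v *m x, (simple D j)^v|))).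
- by move=> x y; rewrite mulmxDr euclidDl.
- by move=> c x; rewrite -scalemxAr euclidZl.
- by move=> i; rewrite mxE weightE //; apply: in_P_W => //; exact: in_P_fund.
Qed.

Lemma weight_mxV v : in_W v -> weight_mx v *m weight_mx (invmx v) = 1%:M.
Proof.
move=> wv; apply/row_matrixP => i.
rewrite row_mul row_weight_mx weight_W; last exact: in_WV.
  by rewrite mulKmx ?(isom_unit (in_W_isom wv)) // weight_fund row1.
by apply: in_P_W => //; exact: in_P_fund.
Qed.

Lemma weight_neq0 a : a \in rt -> weight a != 0.
Proof.
move=> ra; apply: contraNneq (root_neq0 ra) => w0.
by rewrite (weight_sum (in_P_root ra)) w0 big1 // => i _; rewrite mxE scale0r.
Qed.

End Lattice.

(** * The factors of the operators as fractions of monomials *)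

Section Factors.
Context {R : realType} {n : nat} (D : rootData R n) (k : fieldType) (m : nat).
Implicit Types (a b x y : 'cV[R]_n) (v w : 'M[R]_n) (A : aff (R := R) (n := n)).

Local Notation "(| x , y |)" := (euclid (gram D) x y).
Local Notation rt := (Defs.roots D).
Local Notation pos := (pos_root D).
Local Notation "a ^v" := (coroot D a) (at level 2, format "a ^v").
Local Notation in_P := (in_P D).
Local Notation in_W := (in_W D).
Local Notation nc := (ncoef D).
Local Notation N := (nvar D).
Local Notation F := {fraction (mpoly (nvar D) k)}.
Local Notation weight := (weight D).
Local Notation weight_mx := (weight_mx D).
Local Notation fund := (fund_weight D).
Implicit Types (c : 'rV[int]_(ncoef D)) (g : F).

(** The exponents of q and of the t_nu are kept apart from those of the X_i. *)
Definition mon2 c (u : 'rV[int]_n) : F := @mon (nvar D) k (row_mx c u).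

Lemma mon2D c c' u u' : mon2 (c + c') (u + u') = mon2 c u * mon2 c' u'.
Proof. by rewrite /mon2 -add_row_mx monD. Qed.

Lemma var_coef (i : 'I_nc) (e : int) :
  @var R n D k (lshift n i) ^ e = mon2 (e *: delta_mx 0 i) 0.
Proof.
rewrite /mon2 -[var k _]/(mvar (lshift n i)) -mon_delta -monZ; congr mon.
apply/rowP => j; rewrite -[j]splitK; case: (split j) => l /=.
  by rewrite row_mxEl !mxE (inj_eq (@lshift_inj _ _)).
by rewrite row_mxEr !mxE eq_rlshift mulr0.
Qed.

Lemma XmonE b : Xmon D k b = mon2 0 (weight b).
Proof.
rewrite /mon2 /Defs.Xmon /mon big_split_ord /=.
rewrite [X in _ = X * _]big1 ?mul1r => [|i _]; last first.
  by rewrite row_mxEl mxE expr0z.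
by apply: eq_bigr => i _; rewrite row_mxEr mxE.
Qed.

Definition q_vec (e : int) : 'rV[int]_nc := e *: delta_mx 0 ord0.
Definition t_pos (z : R) : 'I_nc := inord (index z (nuR D)).+1.
Definition t_vec (z r : R) : 'rV[int]_nc := Num.floor (2 * r) *: delta_mx 0 (t_pos z).
Definition rho_vec x : 'rV[int]_nc := \sum_(z <- nuR D) t_vec z (|rhov D z, x|).

Lemma qpowE r : qpow D k m r = mon2 (q_vec (Num.floor (m%:R * r))) 0.
Proof. exact: var_coef. Qed.

Lemma tpowE z r : tpow D k z r = mon2 (t_vec z r) 0.
Proof. exact: var_coef. Qed.

Lemma q_rhoE x : q_rho D k x = mon2 (rho_vec x) 0.
Proof.
rewrite /q_rho /mon2 /rho_vec; under eq_bigr => z _ do rewrite tpowE.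
elim: (nuR D) => [|z s IH]; first by rewrite !big_nil row_mx0 mon0.
by rewrite !big_cons IH -mon2D addr0.
Qed.

Lemma mon2V c u : (mon2 c u)^-1 = mon2 (- c) (- u).
Proof. by rewrite /mon2 -opp_row_mx monN. Qed.


(** The exponents of a substitution that fixes q and the t_nu: the i-th row of [M]
    and of [C] are the exponents of the monomial substituted for X_i. *)
Definition exps (C : 'M[int]_(n, nc)) (M : 'M[int]_n) : 'M[int]_N :=
  block_mx 1%:M 0 C M.

Lemma exps_inv C M M' : M *m M' = 1%:M -> exps C M *m exps (- (M' *m C)) M' = 1%:M.
Proof.
move=> MM'; rewrite /exps mulmx_block !mul1mx !mul0mx mulmx0 !addr0 mulmx1 MM'.
by rewrite mulmxN mulmxA MM' mul1mx subrr add0r -scalar_mx_block.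
Qed.

Lemma substE (h : 'I_n -> F) C M : (forall i, h i = mon2 (row i C) (row i M)) ->
  subst h =1 fsubst (mx_image (exps C M)).
Proof.
move=> hE f; rewrite /subst /fsubst /ev.
have E p : mpoly.mmap (fun c : k => tofrac (mpolyC N c))
    (fun j : 'I_N => if split j is inr i then h i else var k j) p =
  mpoly.mmap (@tofrac _ \o @mpolyC N k) (mx_image (exps C M)) p.
  apply: eq_bigr => e _; congr (_ * _); apply: eq_bigr => j _; congr (_ ^+ _).
  rewrite /mx_image /exps block_mxEv; case: splitP => i ji.
    have -> : j = lshift n i by exact: val_inj.
    rewrite rowKu row_row_mx row1 row0 -[RHS]/(mon2 _ _).
    by rewrite -[delta_mx _ _]scale1r -var_coef expr1z.
  have -> : j = rshift nc i by exact: val_inj.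
  by rewrite rowKd row_row_mx hE.
by rewrite !E.
Qed.

(** [f_A] if [is_f] holds and [g_A] otherwise, where X_A has the coefficient with
    exponents c. All powers of q are allowed, as they do not matter for orders. *)
Definition factor (is_f : bool) a c : F :=
  let Y := (mon2 c (weight a))^-1 in let t := tpow D k (nu D a) 1 in
  if is_f then (t * Y - 1) / (Y - 1) else (t - 1) / (1 - Y).

Lemma XaffE A : Xaff D k m A = mon2 (q_vec (Num.floor (m%:R * A.2))) (weight A.1).
Proof. by rewrite /Xaff XmonE qpowE -mon2D addr0 add0r. Qed.

Lemma f_affE A : f_aff D k m A = factor true A.1 (q_vec (Num.floor (m%:R * A.2))).
Proof. by rewrite /f_aff XaffE. Qed.

Lemma g_affE A : g_aff D k m A = factor false A.1 (q_vec (Num.floor (m%:R * A.2))).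
Proof. by rewrite /g_aff XaffE. Qed.

Lemma mon2_exps c u C M M' : M *m M' = 1%:M ->
  fsubst (mx_image (exps C M)) (mon2 c u) = mon2 (c + u *m C) (u *m M).
Proof.
move=> MM'; rewrite /mon2 (fsubst_mx_mon (exps_inv C MM')); congr mon.
by rewrite mul_row_block mulmx1 mulmx0 add0r.
Qed.

Lemma factor_exps is_f a b c C M M' : M *m M' = 1%:M ->
  weight a *m M = weight b -> nu D a = nu D b ->
  fsubst (mx_image (exps C M)) (factor is_f a c) = factor is_f b (c + weight a *m C).
Proof.
move=> MM' wab nab; have EE' := exps_inv C MM'.
rewrite /factor tpowE; case: is_f;
  rewrite !(fsubst_mxM EE', fsubst_mxV EE', fsubst_mxB EE', fsubst_mx1 EE') !(mon2_exps _ _ _ MM');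
  by rewrite wab nab tpowE !mul0mx addr0.
Qed.

Lemma W_act_exps v : W_act (k := k) (D := D) v =1 fsubst (mx_image (exps 0 (weight_mx v))).
Proof. by apply: substE => i; rewrite XmonE row0 row_weight_mx. Qed.

(** Only the exponent of q is changed, so the matrix [C] has rank one. *)
Lemma Gam_act_exps b :
  Gam_act (k := k) (D := D) m b =1 fsubst (mx_image (exps
    ((\col_i Num.floor (m%:R * (|fund i, b|))) *m delta_mx 0 ord0) 1%:M)).
Proof.
apply: substE => i; rewrite XmonE qpowE -mon2D addr0 add0r weight_fund row1.
congr mon2; rewrite row_mul [row i _]mx11_scalar mul_scalar_mx /q_vec.
by rewrite !mxE.
Qed.

Lemma W_act_factor v is_f a c : in_W v -> in_P a ->
  W_act v (factor is_f a c) = factor is_f (v *m a) c.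
Proof.
move=> wv pa; rewrite W_act_exps (factor_exps _ _ _ (weight_mxV wv) (weight_W pa wv)).
  by rewrite mulmx0 addr0.
by rewrite isom_nu //; exact: in_W_isom.
Qed.

Lemma Gam_act_factor b is_f a (e : int) : exists e' : int,
  Gam_act m b (factor is_f a (q_vec e)) = factor is_f a (q_vec e').
Proof.
rewrite Gam_act_exps (factor_exps _ _ _ (mulmx1 1%:M) (mulmx1 _) erefl).
set C := \col_i _; exists (e + (weight a *m C) 0 0); congr factor.
by rewrite mulmxA [X in X *m _]mx11_scalar mul_scalar_mx /q_vec scalerDl.
Qed.

Lemma W_act1 v : in_W v -> W_act v (1 : F) = 1.
Proof. by move=> wv; rewrite W_act_exps (fsubst_mx1 (exps_inv 0 (weight_mxV wv))). Qed.

Lemma W_actM v f g : in_W v -> W_act v (f * g) = W_act v f * W_act v g.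
Proof. by move=> wv; rewrite !W_act_exps (fsubst_mxM (exps_inv 0 (weight_mxV wv))). Qed.

Lemma W_actN v f : in_W v -> W_act v (- f) = - W_act v f :> F.
Proof. by move=> wv; rewrite !W_act_exps (fsubst_mxN (exps_inv 0 (weight_mxV wv))). Qed.

Lemma Gam_act1 b : Gam_act m b (1 : F) = 1.
Proof. by rewrite Gam_act_exps (fsubst_mx1 (exps_inv _ (mulmx1 1%:M))). Qed.

Lemma Gam_actM b f g : Gam_act m b (f * g) = Gam_act m b f * Gam_act m b g :> F.
Proof. by rewrite !Gam_act_exps (fsubst_mxM (exps_inv _ (mulmx1 1%:M))). Qed.

Lemma Gam_actN b f : Gam_act m b (- f) = - Gam_act m b f :> F.
Proof. by rewrite !Gam_act_exps (fsubst_mxN (exps_inv _ (mulmx1 1%:M))). Qed.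

(** The coefficient of zeta_w in [kappa_fun]. *)
Definition kappa_at w : F -> F := subst (fun i =>
  let c := invmx w *m fund i in (q_rho D k c)^-1 * Xmon D k c).

Definition rho_mx w : 'M[int]_(n, nc) :=
  \matrix_(i, j) (- rho_vec (invmx w *m fund i)) 0 j.

Lemma kappa_at_exps w :
  kappa_at w =1 fsubst (mx_image (exps (rho_mx w) (weight_mx (invmx w)))).
Proof.
apply: substE => i /=; rewrite XmonE q_rhoE mon2V -mon2D oppr0 addr0 add0r.
rewrite row_weight_mx; congr mon2.
by apply/rowP => j; rewrite !mxE.
Qed.

(** * Orders of the factors in t_z *)

Section Orders.
Variable z : R.
Hypothesis hz : z \in nuR D.

Lemma t_pos_val z' : z' \in nuR D -> t_pos z' = (index z' (nuR D)).+1 :> nat.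
Proof. by move=> z'R; rewrite inordK // ltnS index_mem. Qed.

Lemma t_pos_eq z' : z' \in nuR D -> (t_pos z == t_pos z') = (z == z').
Proof.
move=> z'R; apply/eqP/eqP => [/(congr1 val) /=|-> //].
rewrite !t_pos_val // => -[e].
by rewrite -(nth_index 0 hz) e nth_index.
Qed.

Lemma nu_mem a : a \in rt -> nu D a \in nuR D.
Proof. by move=> ra; rewrite mem_undup map_f. Qed.

Lemma q_vec_t e : q_vec e 0 (t_pos z) = 0.
Proof.
rewrite !mxE /=; have -> : (t_pos z == ord0) = false.
  by apply/eqP => /(congr1 val) /=; rewrite t_pos_val.
by rewrite mulr0.
Qed.

Lemma t_vec_t z' r : z' \in nuR D ->
  t_vec z' r 0 (t_pos z) = Num.floor (2 * r) * (z == z')%:R.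
Proof. by move=> z'R; rewrite !mxE /= t_pos_eq. Qed.

Lemma rho_vec_t x : rho_vec x 0 (t_pos z) = Num.floor (2 * (|rhov D z, x|)).
Proof.
rewrite summxE (bigD1_seq z hz (undup_uniq _)) /= t_vec_t // eqxx mulr1.
rewrite big_seq_cond big1 ?addr0 // => z' /andP[z'R ne].
by rewrite t_vec_t // eq_sym (negbTE ne) mulr0.
Qed.

Lemma z_neq0 : z != 0.
Proof.
move: hz; rewrite mem_undup => /mapP[a ra ->]; exact: nu_neq0.
Qed.

Lemma rhov_height2 x : 2 * (|rhov D z, x|) = height2 D z x.
Proof.
have z0 := z_neq0; rewrite /rhov euclidZl euclid_suml mulrA.
have -> : 2 * (2 * z)^-1 = z^-1 by field.
rewrite mulr_sumr; apply: eq_bigr => a /andP[_ /eqP az].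
by rewrite corootE euclidZr az (euclidC D a).
Qed.

Lemma height2_int x : in_P x -> (Num.floor (2 * (|rhov D z, x|)))%:~R = height2 D z x.
Proof.
move=> px; rewrite rhov_height2 floorK // /height2 big_seq_cond rpred_sum //.
by move=> a /andP[ra _]; exact: in_P_coroot.
Qed.

Lemma height2D x y : height2 D z (x + y) = height2 D z x + height2 D z y.
Proof. by rewrite /height2 -big_split /=; apply: eq_bigr => a _; rewrite euclidDl. Qed.

Lemma height2Z (c : R) x : height2 D z (c *: x) = c * height2 D z x.
Proof. by rewrite /height2 mulr_sumr; apply: eq_bigr => a _; rewrite euclidZl. Qed.

(** By [height2_turn] with the identity, as the terms at a and -a are 2. *)
Lemma height2_pos a : pos a -> 2 * (nu D a == z)%:R <= height2 D z a.
Proof.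
move=> pa; have ra := pos_mem pa; have i1 := isom1 D.
have n1 : neg D (1%:M *m a) = 0 by rewrite mul1mx /neg pa.
have F0 b : b \in rt -> 0 <= turn D 1%:M a b * (|a, b^v|).
  move=> rb; have := turn_sign_pairing i1 ra rb; rewrite n1 mulr0 subr0 !mul1r.
  case=> [->|[[t c]|[t c]]]; first by rewrite mul0r.
    by rewrite mulr_ge0 //; lra.
  by rewrite mulr_le0 //; lra.
have := sum_root_ge_pair z ra F0; rewrite -height2_turn // mul1mx.
rewrite turnN // corootN euclidNr turn_self // n1 coroot_self //; lra.
Qed.

Local Notation ord := (fval (t_idx D z)).

Lemma ord_mon2 c u : ord (mon2 c u) = c 0 (t_pos z).
Proof. by rewrite /mon2 fval_mon row_mxEl. Qed.

Lemma ord_mon2_sub1 c u : u != 0 -> mon2 c u - 1 != 0 /\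
  ord (mon2 c u - 1) = Num.min (c 0 (t_pos z)) 0.
Proof.
move=> u0; have [|ne E] := @mon_sub1 _ k (t_idx D z) (row_mx c u).
  by apply: contraNneq u0 => /(congr1 rsubmx) /eqP; rewrite row_mxKr linear0.
by split=> //; rewrite E row_mxEl.
Qed.

Lemma ord_factor is_f a c : a \in rt ->
  let e := c 0 (t_pos z) in
  factor is_f a c != 0 /\ ord (factor is_f a c) =
    (if is_f then Num.min (2 * (z == nu D a)%:R - e) 0 else 0) - Num.min (- e) 0.
Proof.
move=> ra e; have w0 := weight_neq0 ra; have nR := nu_mem ra.
have fl2 : Num.floor (2 * 1 : R) = 2 by rewrite mulr1 -[2]/(2%:~R) intrKfloor.
have [Y0 YE] : (mon2 c (weight a))^-1 - 1 != 0 /\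
    ord ((mon2 c (weight a))^-1 - 1) = Num.min (- e) 0.
  rewrite mon2V; have [|n0 ->] := @ord_mon2_sub1 (- c) (- weight a).
    by rewrite oppr_eq0.
  by rewrite mxE.
rewrite /factor tpowE; case: is_f.
  have [T0 TE] : mon2 (t_vec (nu D a) 1) 0 * (mon2 c (weight a))^-1 - 1 != 0 /\
      ord (mon2 (t_vec (nu D a) 1) 0 * (mon2 c (weight a))^-1 - 1) =
      Num.min (2 * (z == nu D a)%:R - e) 0.
    rewrite mon2V -mon2D sub0r.
    have [|n0 ->] := @ord_mon2_sub1 (t_vec (nu D a) 1 - c) (- weight a).
      by rewrite oppr_eq0.
    by split=> //; rewrite mxE t_vec_t // fl2 mxE.
  by have [n0 ->] := fval_div (t_idx D z) T0 Y0; rewrite TE YE.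
have YN : 1 - (mon2 c (weight a))^-1 = - ((mon2 c (weight a))^-1 - 1).
  by rewrite opprB.
have Y0' : 1 - (mon2 c (weight a))^-1 != 0 by rewrite YN oppr_eq0.
have YE' : ord (1 - (mon2 c (weight a))^-1) = Num.min (- e) 0.
  by rewrite YN (fvalN _ Y0) YE.
have [T0 TE] : mon2 (t_vec (nu D a) 1) 0 - 1 != 0 /\
    ord (mon2 (t_vec (nu D a) 1) 0 - 1) = 0.
  have [|n0 E] := @mon_sub1 _ k (t_idx D z) (row_mx (t_vec (nu D a) 1) 0).
    apply/negP => /eqP /(congr1 lsubmx); rewrite row_mxKl linear0.
    by move=> /rowP /(_ (t_pos (nu D a))) /eqP; rewrite !mxE !eqxx fl2.
  split=> //; rewrite E row_mxEl t_vec_t // fl2.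
  by case: (_ == _).
by have [n0 ->] := fval_div (t_idx D z) T0 Y0'; rewrite TE YE'.
Qed.

(** If Y denotes the value of X_A^(-1) under kappa^delta, its order is
    [height2 (invmx w *m a)]; as Y involves the X_i, the orders of [t Y - 1] and
    [Y - 1] are read off from Y by [mon_sub1]. The bound of [height2_pos] shows
    that the order of [f] only depends on the sign of [invmx w *m a]. *)
Lemma kappa_factor w is_f a e : in_W w -> a \in rt ->
  kappa_at w (factor is_f a (q_vec e)) != 0 /\
  (ord (kappa_at w (factor is_f a (q_vec e))))%:~R =
    if is_f then f_cost D z (invmx w) a else g_cost D z (invmx w) a.
Proof.
move=> ww ra; have wV := in_WV ww; have iv := in_W_isom wV.
rewrite kappa_at_exps (factor_exps _ _ _ (weight_mxV wV) (weight_W (in_P_root ra) wV));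
  last by rewrite isom_nu.
set c := q_vec e + _; have rb := iv.2 _ ra; set b := invmx w *m a in rb *.
have [f0 ->] := ord_factor is_f c rb; split=> //.
have cE : (- c 0 (t_pos z))%:~R = height2 D z b.
  rewrite mxE q_vec_t add0r mxE.
  have -> : - (\sum_j weight a 0 j * rho_mx w j (t_pos z)) =
      \sum_j weight a 0 j * rho_vec (invmx w *m fund j) 0 (t_pos z).
    by rewrite -sumrN; apply: eq_bigr => j _; rewrite !mxE mulrN opprK.
  apply: (weight_linear (in_P_root ra) (phi := fun x => height2 D z (invmx w *m x))).
  - by move=> x y; rewrite mulmxDr height2D.
  - by move=> r x; rewrite -scalemxAr height2Z.
  - by move=> j; rewrite rho_vec_t height2_int //; apply: in_P_W => //; exact: in_P_fund.
rewrite /f_cost /g_cost -/b -cE; move: cE; set h := - c 0 (t_pos z) => cE.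
rewrite -(isom_nu a iv) -/b; rewrite (eq_sym z).
case: (is_f); last first.
  rewrite sub0r; case: (leP 0 h) => h0.
    by rewrite oppr0 max_l // oppr_le0 ler0z.
  by rewrite rmorphN max_r // oppr_ge0 lerz0 ltW.
have [pb|npb] := boolP (pos b).
  rewrite andbF mulr0; have := height2_pos pb; rewrite -cE.
  have -> : 2 * (nu D b == z)%:R = (2 * (nu D b == z)%:Z)%:~R :> R.
    by rewrite rmorphM.
  by rewrite ler_int => h0; rewrite !min_r ?subrr //; case: (_ == _) h0 => /=; lia.
have := height2_pos (a := - b); rewrite posN // npb => /(_ isT).
rewrite nuN -scaleN1r height2Z mulN1r -cE andbT.
have -> : 2 * (nu D b == z)%:R = (2 * (nu D b == z)%:Z)%:~R :> R.
  by rewrite rmorphM.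
rewrite -rmorphN ler_int => h0; congr (_%:~R).
by case: (_ == _) h0 => /= h0; rewrite !min_l; lia.
Qed.

End Orders.

End Factors.

(** * Products of difference-reflection terms *)

Section Expansions.
Context {R : realType} {n : nat} (D : rootData R n) (k : fieldType) (m : nat).
Variable z : R.
Hypothesis hz : z \in nuR D.
Implicit Types (a b x y : 'cV[R]_n) (v w : 'M[R]_n).

Local Notation aff := (Defs.aff (R := R) (n := n)).
Local Notation rt := (Defs.roots D).
Local Notation isom := (isom D).
Local Notation in_P := (in_P D).
Local Notation in_W := (in_W D).
Local Notation F := {fraction (mpoly (nvar D) k)}.
Local Notation height2 := (height2 D z).
Local Notation ord := (fval (t_idx D z)).
Implicit Types (g : F) (L : seq (bool * 'cV[R]_n)).

Lemma msuppU_neq0 (K : choiceType) (G : zmodType) (x : K) (g : G) : g != 0 ->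
  monalg.msupp (monalg.mkmalgU x g) = [fset x]%fset.
Proof. by move=> g0; rewrite monalg.msuppU (negbTE g0). Qed.

Lemma msupp_dr_term g a v : g != 0 ->
  monalg.msupp (dr_term g a v : dro D k) = [fset (a, v)]%fset.
Proof. exact: msuppU_neq0. Qed.

Lemma mcoeff_dr_term g a v : monalg.mcoeff (a, v) (dr_term g a v : dro D k) = g.
Proof. exact: monalg.mcoeffUU. Qed.

Lemma dr_mul_supp (U T : dro D k) s t g g' :
  monalg.msupp U = [fset s]%fset -> monalg.mcoeff s U = g ->
  monalg.msupp T = [fset t]%fset -> monalg.mcoeff t T = g' ->
  dr_mul m U T =
  dr_term (g * Gam_act m s.1 (W_act s.2 g')) (s.1 + s.2 *m t.1) (s.2 *m t.2).
Proof. by rewrite /dr_mul => -> <- -> <-; rewrite !big_seq_fset1. Qed.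

Lemma dr_mul_term g g' a a' v v' : g != 0 -> g' != 0 ->
  dr_mul m (dr_term g a v : dro D k) (dr_term g' a' v') =
  dr_term (g * Gam_act m a (W_act v g')) (a + v *m a') (v *m v').
Proof.
move=> g0 g'0; exact: dr_mul_supp (msupp_dr_term a v g0) (mcoeff_dr_term g a v)
  (msupp_dr_term a' v' g'0) (mcoeff_dr_term g' a' v').
Qed.

Lemma sp_mul_supp (U T : spo D k) w s t g g' :
  monalg.msupp (U w) = [fset s]%fset -> monalg.mcoeff s (U w) = g ->
  monalg.msupp (T (invmx s.2 *m w)) = [fset t]%fset ->
  monalg.mcoeff t (T (invmx s.2 *m w)) = g' ->
  sp_mul m U T w = dr_term (g * Gam_act m s.1 g') (s.1 + t.1) (s.2 *m t.2).
Proof.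
by rewrite /sp_mul => -> <-; rewrite big_seq_fset1 => -> <-; rewrite big_seq_fset1.
Qed.

Lemma sp_mul_term (U T : spo D k) w g g' a a' v v' : g != 0 -> g' != 0 ->
  U w = dr_term g a v -> T (invmx v *m w) = dr_term g' a' v' ->
  sp_mul m U T w = dr_term (g * Gam_act m a g') (a + a') (v *m v').
Proof.
move=> g0 g'0 E E'; apply: (@sp_mul_supp U T w (a, v) (a', v')).
- by rewrite E; exact: (msupp_dr_term a v g0).
- by rewrite E; exact: (mcoeff_dr_term g a v).
- by rewrite E'; exact: (msupp_dr_term a' v' g'0).
- by rewrite E'; exact: (mcoeff_dr_term g' a' v').
Qed.

Lemma kappa_supp (U : dro D k) w s g :
  monalg.msupp U = [fset s]%fset -> monalg.mcoeff s U = g ->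
  kappa m U w = sp_mul m (sp_mul m (kappa_fun g) (kappa_Gam D k s.1))
    (kappa_W D k s.2) w.
Proof. by rewrite /kappa => -> <-; rewrite big_seq_fset1. Qed.

Lemma invmx1 : invmx (1%:M : 'M[R]_n) = 1%:M.
Proof. by rewrite -[LHS]mulmx1 mulVmx // unitmx1. Qed.

Lemma Gam_act0_mon2 c u : Gam_act m 0 (mon2 (D := D) k c u) = mon2 k c u.
Proof.
rewrite Gam_act_exps (mon2_exps k _ _ _ (mulmx1 1%:M)) mulmx1; congr (mon2 k).
rewrite mulmxA (_ : u *m _ = 0) ?mul0mx ?addr0 //.
apply/colP => i; rewrite !mxE big1 // => j _; rewrite !mxE.
by rewrite euclidC euclid0l mulr0 floor0 mulr0.
Qed.

Lemma kappa_term w g a : in_W w -> kappa_at w g != 0 ->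
  kappa m (dr_term g a 1%:M : dro D k) w =
  dr_term (kappa_at w g * (q_rho D k (invmx w *m a))^-1) (invmx w *m a) 1%:M.
Proof.
move=> ww g0'; have g0 : g != 0.
  have wV := in_WV ww; move: g0'; rewrite kappa_at_exps.
  by rewrite (fsubst_mx_eq0 (exps_inv _ (weight_mxV wV))).
set b := invmx w *m a; set q := (q_rho D k b)^-1.
have q0 : q != 0 by rewrite /q q_rhoE invr_eq0 mon_neq0.
have qE : Gam_act m 0 q = q by rewrite /q q_rhoE mon2V Gam_act0_mon2.
have eK : kappa_Gam D k a (invmx 1%:M *m w) = dr_term q b 1%:M.
  by rewrite invmx1 mul1mx.
have := sp_mul_term g0' q0 (erefl : kappa_fun g w = _) eK.
rewrite qE add0r mulmx1 => E1.
have n1 := mulf_neq0 g0' q0.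
have := sp_mul_term n1 (oner_neq0 _) E1 (erefl : kappa_W D k 1%:M _ = dr_term 1 0 1%:M).
rewrite (Gam_act1 D k m b) mulr1 addr0 mulmx1 => E2.
rewrite -[RHS]E2.
exact: (kappa_supp w (msupp_dr_term a 1%:M g0) (mcoeff_dr_term g a 1%:M)).
Qed.


(** [g] is, up to sign, a product of factors at the roots listed in [L]; the
    powers of q in the factors are irrelevant. *)
Fixpoint factors L g : Prop :=
  if L is (is_f, a) :: L' then
    exists e g', factors L' g' /\ g = factor k is_f a (q_vec D e) * g'
  else g = 1 \/ g = -1.

(** The order in [t_z^(1/2)] of a product of factors, see [kappa_factors]. *)
Definition cost v L : R :=
  \sum_(f <- L) if f.1 then f_cost D z v f.2 else g_cost D z v f.2.

Lemma cost_nil v : cost v [::] = 0.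
Proof. by rewrite /cost big_nil. Qed.

Lemma cost_cons v f L : cost v (f :: L) =
  (if f.1 then f_cost D z v f.2 else g_cost D z v f.2) + cost v L.
Proof. by rewrite /cost big_cons. Qed.

Lemma cost_f_factors v (As : seq aff) :
  cost v [seq (true, A.1) | A <- As] = \sum_(A <- As) f_cost D z v A.1.
Proof. by rewrite /cost big_map. Qed.

Definition act v L := [seq (f.1, v *m f.2) | f <- L].

Definition root_list L := forall f, f \in L -> f.2 \in rt.

Lemma root_list_cons f L : root_list (f :: L) -> f.2 \in rt /\ root_list L.
Proof.
by move=> r; split=> [|h hL]; apply: r; rewrite inE ?eqxx // hL orbT.
Qed.

Lemma root_list_act v L : isom v -> root_list L -> root_list (act v L).
Proof. by move=> iv rL _ /mapP[f fL ->]; exact/iv.2/rL. Qed.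

Lemma cost_act v w L : isom w -> cost v (act w L) = cost (v *m w) L.
Proof.
move=> iw; rewrite /cost big_map; apply: eq_bigr => f _ /=.
by rewrite /f_cost /g_cost isom_nu // mulmxA.
Qed.

Lemma factorsN L g : factors L g -> factors L (- g).
Proof.
elim: L g => [|[is_f a] L IH] g /=; first by case=> ->; rewrite ?opprK; [right|left].
by case=> e [g' [/IH Lg' ->]]; exists e, (- g'); rewrite mulrN.
Qed.

Lemma factors_Gam L g b : factors L g -> factors L (Gam_act m b g).
Proof.
elim: L g => [|[is_f a] L IH] g /=.
  by case=> ->; rewrite ?Gam_actN Gam_act1; [left|right].
case=> e [g' [/IH Lg' ->]]; rewrite Gam_actM.
have [e' ->] := Gam_act_factor D k m b is_f a e.
by exists e', (Gam_act m b g').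
Qed.

Lemma factors_W v L g : in_W v -> root_list L -> factors L g ->
  factors (act v L) (W_act v g).
Proof.
move=> wv; elim: L g => [|[is_f a] L IH] g /=.
  by move=> _ [] ->; rewrite ?(W_actN _ wv) (W_act1 k wv); [left|right].
move=> /root_list_cons[/= ra rL] [e [g' [/(IH _ rL) Lg' ->]]].
rewrite (W_actM _ _ wv) (W_act_factor k _ _ wv (in_P_root ra)).
by exists e, (W_act v g').
Qed.

Lemma Gam_act0_factor is_f a c : Gam_act m 0 (factor (D := D) k is_f a c) = factor k is_f a c.
Proof.
rewrite /factor tpowE Gam_act_exps; set S := fsubst _.
have SM f g : S (f * g) = S f * S g by exact: (fsubst_mxM (exps_inv _ (mulmx1 1%:M))).
have SB f g : S (f - g) = S f - S g by exact: (fsubst_mxB (exps_inv _ (mulmx1 1%:M))).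
have SV f : S f^-1 = (S f)^-1 by exact: (fsubst_mxV (exps_inv _ (mulmx1 1%:M))).
have S1 : S 1 = 1 by exact: (fsubst_mx1 (exps_inv _ (mulmx1 1%:M))).
have Sm c' u : S (mon2 k c' u) = mon2 k c' u.
  by rewrite -[RHS]Gam_act0_mon2 Gam_act_exps.
by case: is_f; rewrite !(SM, SB, SV, S1, Sm).
Qed.

Lemma factors_W_preim v L g : in_W v -> root_list L -> factors L g ->
  exists2 g1, factors (act (invmx v) L) g1 & Gam_act m 0 (W_act v g1) = g.
Proof.
move=> wv; have wV := in_WV wv; have vu := isom_unit (in_W_isom wv).
elim: L g => [|[is_f a] L IH] g /=.
  move=> _ [] ->.
    by exists 1; [left|rewrite (W_act1 k wv) Gam_act1].
  by exists (-1); [right|rewrite (W_actN _ wv) (W_act1 k wv) Gam_actN Gam_act1].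
move=> /root_list_cons[/= ra rL] [e [g' [/(IH _ rL)[g1 Lg1 E] ->]]].
exists (factor k is_f (invmx v *m a) (q_vec D e) * g1); first by exists e, g1.
have pa : in_P (invmx v *m a) by exact/in_P_W/in_P_root.
rewrite (W_actM _ _ wv) (W_act_factor k _ _ wv pa) mulKVmx // Gam_actM E.
by rewrite Gam_act0_factor.
Qed.

Lemma factors_neq0 L g : root_list L -> factors L g -> g != 0.
Proof.
elim: L g => [|[is_f a] L IH] g /=; first by move=> _ [] ->; rewrite ?oppr_eq0 oner_eq0.
move=> /root_list_cons[/= ra rL] [e [g' [/(IH _ rL) g0 ->]]].
by have [f0 _] := ord_factor k hz is_f (q_vec D e) ra; exact: (mulf_neq0 f0 g0).
Qed.

Lemma kappa_factors w L g : in_W w -> root_list L -> factors L g ->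
  kappa_at w g != 0 /\ (ord (kappa_at w g))%:~R = cost (invmx w) L.
Proof.
move=> ww; have E := exps_inv (rho_mx D w) (weight_mxV (in_WV ww)).
elim: L g => [|[is_f a] L IH] g.
  move=> _ Lg; rewrite /cost big_nil !kappa_at_exps (fsubst_mx_eq0 E).
  have n1 : 1 != 0 :> F := oner_neq0 _.
  case: Lg => ->; last by rewrite (fsubst_mxN E) (fsubst_mx1 E) (fvalN _ n1) fval1 oppr_eq0.
  by rewrite (fsubst_mx1 E) fval1.
move=> /root_list_cons[/= ra rL] [e [g' [/(IH _ rL)[g0 gE] ->]]].
have [f0 fE] := kappa_factor k hz is_f e ww ra.
have -> : kappa_at w (factor k is_f a (q_vec D e) * g') =
    kappa_at w (factor k is_f a (q_vec D e)) * kappa_at w g'.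
  by rewrite !kappa_at_exps (fsubst_mxM E).
split; first exact: (mulf_neq0 f0 g0).
by rewrite (fvalM _ f0 g0) rmorphD /= fE gE /cost big_cons.
Qed.

Lemma ord_kappa_factors w L g a : in_W w -> root_list L -> factors L g -> in_P a ->
  exists2 c : int, ord_kappa m w z g a = (c%:~R / 2)%:E &
    c%:~R = cost (invmx w) L - height2 (invmx w *m a).
Proof.
move=> ww rL Lg pa; have [g0 gE] := kappa_factors ww rL Lg.
have q0 : q_rho D k (invmx w *m a) != 0 by rewrite q_rhoE mon_neq0.
have [h0 hE] := fval_div (t_idx D z) g0 q0.
exists (ord (kappa_at w g / q_rho D k (invmx w *m a))).
  rewrite /ord_kappa /sp_coef (kappa_term _ ww g0) monalg.mcoeffUU /ord_t (negbTE h0).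
  by rewrite /fval rmorphB.
rewrite hE rmorphB /= gE q_rhoE ord_mon2.
by rewrite (rho_vec_t hz) (height2_int hz) //; apply: in_P_W => //; exact: in_WV.
Qed.

End Expansions.

(** * Normal forms of the products in an expansion *)

Section NormalForms.
Context {R : realType} {n : nat} (D : rootData R n) (k : fieldType) (m : nat).
Variable z : R.
Hypothesis hz : z \in nuR D.
Implicit Types (a b x y : 'cV[R]_n) (v w : 'M[R]_n).

Local Notation aff := (Defs.aff (R := R) (n := n)).
Local Notation rt := (Defs.roots D).
Local Notation sr a := (Defs.refl (gram D) a).
Local Notation isom := (isom D).
Local Notation in_P := (in_P D).
Local Notation in_W := (in_W D).
Local Notation F := {fraction (mpoly (nvar D) k)}.
Local Notation height2 := (height2 D z).
Local Notation cost := (cost D z).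
Local Notation total := (total D z).
Implicit Types (g : F) (L : seq (bool * 'cV[R]_n)) (As : seq aff) (cs : seq bool).

Definition choice_refl (c : bool) (A : aff) : 'M[R]_n := if c then 1%:M else sr A.1.

Fixpoint choices_refl As cs : 'M[R]_n :=
  match As, cs with
  | A :: As', c :: cs' => choice_refl c A *m choices_refl As' cs'
  | _, _ => 1%:M
  end.

Lemma choices_refl_rcons As cs A c : size cs = size As ->
  choices_refl (rcons As A) (rcons cs c) = choices_refl As cs *m choice_refl c A.
Proof.
elim: As cs => [|B As IH] [|d cs] //=; first by rewrite mulmx1 mul1mx.
by case=> /IH ->; rewrite mulmxA.
Qed.

(** Seen from the other end, the last factor is evaluated after all chosen
    reflections. *)
Lemma total_rcons e v As cs A c : size cs = size As ->
  total e v (rcons As A) (rcons cs c) = total e v As cs +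
    (let u := v *m choices_refl As cs in
     if c then f_cost D z u A.1
     else g_cost D z u A.1 - e * (A.2 / nu D A.1 * height2 (u *m A.1))).
Proof.
elim: As cs v => [|B As IH] [|d cs] v //= sz.
  by rewrite mulmx1 add0r; case: c; rewrite addr0.
case: sz => sz; case: d; rewrite IH // /choice_refl.
  by rewrite mul1mx addrA.
by rewrite mulmxA addrA.
Qed.

(** The product in normal form, its reflections moved to the right, with the
    costs of its factors. *)
Definition plus_form As (U : dro D k) := exists cs L a v g,
  [/\ [/\ size cs = size As, U = dr_term g a v, root_list D L & factors L g],
      in_P a, in_W v &
      forall x : 'M[R]_n, isom x -> cost x L - height2 (x *m a) = total 1 x As cs].

(** The normal form is the same for the [Gminus], but the order is taken after
    moving [v] to the left. Then the last factor of the product is the one that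
    is not conjugated, whence the reversed sequences; the translation crosses
    its own reflection, whence the sign in [total]. *)
Definition minus_form As (U : dro D k) := exists cs L a v g,
  [/\ [/\ size cs = size As, U = dr_term g a v, root_list D L & factors L g],
      in_P a, in_W v, invmx v = choices_refl (rev As) (rev cs) &
      forall x : 'M[R]_n, isom x -> cost (x *m invmx v) L - height2 (x *m invmx v *m a) =
        total (-1) x (rev As) (rev cs)].

Lemma dr_mul_factors L g c v L' g' a v' (U : dro D k) :
  in_W v -> root_list D L -> root_list D L' -> factors L g -> factors L' g' ->
  U = dr_term g c v ->
  dr_mul m U (dr_term g' a v') =
    dr_term (g * Gam_act m c (W_act v g')) (c + v *m a) (v *m v').
Proof.
move=> wv rL rL' Lg Lg' ->.
exact: dr_mul_term (factors_neq0 hz rL Lg) (factors_neq0 hz rL' Lg').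
Qed.

Lemma f_factors A : A.1 \in rt ->
  factors [:: (true, A.1)] (f_aff D k m A).
Proof.
move=> rA; rewrite f_affE; exists (Num.floor (m%:R * A.2)), 1.
by rewrite mulr1; split=> //; left.
Qed.

Lemma g_factors A : A.1 \in rt ->
  factors [:: (false, A.1)] (g_aff D k m A).
Proof.
move=> rA; rewrite g_affE; exists (Num.floor (m%:R * A.2)), 1.
by rewrite mulr1; split=> //; left.
Qed.

Lemma root_list1 (c : bool) a : a \in rt -> root_list D [:: (c, a)].
Proof. by move=> ra f; rewrite inE => /eqP ->. Qed.

Definition s_aff_vec (A : aff) : 'cV[R]_n := (A.2 / nu D A.1) *: A.1.

Lemma in_P_s_aff_vec A : aff_root D A -> in_P (s_aff_vec A).
Proof.
move=> [rA [c E]]; rewrite /s_aff_vec E (mulrC (nu D A.1)) mulfK ?nu_neq0 //.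
exact/in_PZ/in_P_root.
Qed.

Lemma s_affE A : s_aff D k m A = dr_term 1 (s_aff_vec A) (sr A.1).
Proof.
rewrite /s_aff /dr_Gam /dr_W (dr_mul_term _ _ _ _ _ (oner_neq0 _) (oner_neq0 _)).
by rewrite (W_act1 k (in_W1 D)) Gam_act1 mulr1 mulmx0 addr0 mul1mx.
Qed.

Lemma Gplus2E A : A.1 \in rt ->
  (Gplus D k m A).2 = dr_term (g_aff D k m A) (s_aff_vec A) (sr A.1).
Proof.
move=> rA; rewrite /= s_affE /dr_fun.
have g0 := factors_neq0 hz (root_list1 (c := false) rA) (g_factors rA).
rewrite (dr_mul_term _ _ _ _ _ g0 (oner_neq0 _)).
by rewrite (W_act1 k (in_W1 D)) Gam_act1 mulr1 add0r !mul1mx.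
Qed.

Lemma Gminus2E A : A.1 \in rt -> exists2 g,
  factors [:: (false, - A.1)] g & (Gminus D k m A).2 = dr_term g (s_aff_vec A) (sr A.1).
Proof.
move=> rA; have ws := in_W_sr rA; have rL := root_list1 (c := false) rA.
have g0 := factors_neq0 hz rL (g_factors rA).
exists (- Gam_act m (s_aff_vec A) (W_act (sr A.1) (g_aff D k m A))).
  apply/factorsN/factors_Gam; have := factors_W ws rL (g_factors rA).
  by rewrite /act /= sr_self.
rewrite /= s_affE /dr_fun (dr_mul_term _ _ _ _ _ (oner_neq0 _) g0).
by rewrite mulmx0 addr0 mulmx1 mul1r /dr_term monalg.monalgUN.
Qed.

Lemma act1 L : act 1%:M L = L.
Proof. by rewrite /act -[RHS]map_id; apply: eq_map => -[b a]; rewrite mul1mx. Qed.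

Lemma factors_cons L g L' g' b v : in_W v -> root_list D L' ->
  (forall f, L = [:: f] -> factors L g -> factors L' g' ->
  factors (f :: act v L') (g * Gam_act m b (W_act v g'))).
Proof.
move=> wv rL' [is_f a] -> /= [e [g1 [g1E ->]]] Lg'.
have L2 := factors_Gam m b (factors_W wv rL' Lg').
case: g1E => ->.
  by exists e, (Gam_act m b (W_act v g')); rewrite mulr1.
exists e, (- Gam_act m b (W_act v g')); split; first exact: factorsN.
by rewrite mulrN1 mulNr mulrN.
Qed.

Lemma root_list_consI (c : bool) a L : a \in rt -> root_list D L -> root_list D ((c, a) :: L).
Proof. by move=> ra rL f; rewrite inE => /predU1P[->|/rL]. Qed.

Lemma height2_0 : height2 0 = 0.
Proof. by have := @height2Z _ _ D z 0 0; rewrite scale0r mul0r. Qed.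

Lemma height2N x : height2 (- x) = - height2 x.
Proof. by rewrite -scaleN1r height2Z mulN1r. Qed.

Lemma expansion_plus As U : (forall A, A \in As -> aff_root D A) ->
  U \in expansion m [seq Gplus D k m A | A <- As] -> plus_form As U.
Proof.
elim: As U => [|A As IH] U rAs.
  rewrite inE => /eqP ->; exists [::], [::], 0, 1%:M, 1; split=> //.
  - by split=> //; left.
  - exact: in_P0.
  - exact: in_W1.
  - by move=> x _; rewrite mulmx0 height2_0 subr0 cost_nil.
have aA : aff_root D A by apply: rAs; rewrite mem_head.
have rA := aA.1; have ws := in_W_sr rA.
have {}rAs B : B \in As -> aff_root D B by move=> BAs; apply: rAs; rewrite inE BAs orbT.
move=> /allpairsP[[V T] [VG /(IH _ rAs) TF] ->]; move: VG TF; rewrite !inE /=.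
case/predU1P=> [->|/eqP ->] [cs [L [a [v [g [[sz -> rL Lg] pa wv E]]]]]].
  have w1 := in_W1 D.
  exists (true :: cs), ((true, A.1) :: L), a, v, (f_aff D k m A * Gam_act m 0 (W_act 1%:M g)).
  split=> //.
    split; [by rewrite /= sz| | exact: root_list_consI|].
      rewrite /dr_fun (dr_mul_factors _ _ w1 (root_list1 (c := true) rA) rL (f_factors rA) Lg erefl).
      by rewrite add0r !mul1mx.
    by rewrite -{1}[L]act1; apply: factors_cons (f_factors rA) Lg.
  by move=> x ix; rewrite cost_cons /= -E // addrA.
have sE := Gplus2E rA; rewrite /= in sE.
exists (false :: cs), ((false, A.1) :: act (sr A.1) L), (s_aff_vec A + sr A.1 *m a),
  (sr A.1 *m v), (g_aff D k m A * Gam_act m (s_aff_vec A) (W_act (sr A.1) g)).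
have is_ := isom_sr rA; split.
- split; [by rewrite /= sz| | exact/root_list_consI/root_list_act|].
    exact: (dr_mul_factors _ _ ws (root_list1 (c := false) rA) rL (g_factors rA) Lg sE).
  exact: factors_cons (g_factors rA) Lg.
- by apply: in_PD; [exact: in_P_s_aff_vec|exact: in_P_W].
- exact: in_WM.
- move=> x ix; rewrite cost_cons /= cost_act // -E; last exact: isomM.
  rewrite (mulmxDr x (s_aff_vec A)) height2D /s_aff_vec -scalemxAr height2Z mulmxA mul1r; ring.
Qed.

Lemma expansion_minus As U : (forall A, A \in As -> aff_root D A) ->
  U \in expansion m [seq Gminus D k m A | A <- As] -> minus_form As U.
Proof.
elim: As U => [|A As IH] U rAs.
  rewrite inE => /eqP ->; exists [::], [::], 0, 1%:M, 1; split=> //.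
  - by split=> //; left.
  - exact: in_P0.
  - exact: in_W1.
  - exact: invmx1.
  - by move=> x _; rewrite mulmx0 height2_0 subr0 cost_nil.
have aA : aff_root D A by apply: rAs; rewrite mem_head.
have rA := aA.1; have ws := in_W_sr rA.
have {}rAs B : B \in As -> aff_root D B by move=> BAs; apply: rAs; rewrite inE BAs orbT.
move=> /allpairsP[[V T] [VG /(IH _ rAs) TF] ->]; move: VG TF; rewrite !inE /=.
case/predU1P=> [->|/eqP ->] [cs [L [a [v [g [[sz -> rL Lg] pa wv vE E]]]]]].
  have w1 := in_W1 D; have sz' : size (rev cs) = size (rev As) by rewrite !size_rev.
  exists (true :: cs), ((true, A.1) :: L), a, v, (f_aff D k m A * Gam_act m 0 (W_act 1%:M g)).
  split=> //.
  - split; [by rewrite /= sz| | exact: root_list_consI|].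
      rewrite /dr_fun (dr_mul_factors _ _ w1 (root_list1 (c := true) rA) rL (f_factors rA) Lg erefl).
      by rewrite add0r !mul1mx.
    by rewrite -{1}[L]act1; apply: factors_cons (f_factors rA) Lg.
  - by rewrite !rev_cons choices_refl_rcons // -vE mulmx1.
  - move=> x ix; rewrite cost_cons /= !rev_cons total_rcons // -E // -vE /=.
    by ring.
have [g1 Lg1 sE] := Gminus2E rA; rewrite /= in sE.
have sz' : size (rev cs) = size (rev As) by rewrite !size_rev.
have rNA : - A.1 \in rt by rewrite rootN.
have is_ := isom_sr rA; have iv := in_W_isom wv.
have svV : invmx (sr A.1 *m v) = invmx v *m sr A.1.
  have su := isom_unit is_; have vu := isom_unit iv.
  have E1 : invmx v *m sr A.1 *m (sr A.1 *m v) = 1%:M.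
    by rewrite -mulmxA (mulmxA (sr A.1)) sr_sq // mul1mx mulVmx.
  by rewrite -[LHS]mul1mx -E1 mulmxK // unitmx_mul su.
exists (false :: cs), ((false, - A.1) :: act (sr A.1) L), (s_aff_vec A + sr A.1 *m a),
  (sr A.1 *m v), (g1 * Gam_act m (s_aff_vec A) (W_act (sr A.1) g)).
split.
- split; [by rewrite /= sz| | exact/root_list_consI/root_list_act|].
    exact: (dr_mul_factors _ _ ws (root_list1 (c := false) rNA) rL Lg1 Lg sE).
  exact: factors_cons Lg1 Lg.
- by apply: in_PD; [exact: in_P_s_aff_vec|exact: in_P_W].
- exact: in_WM.
- by rewrite !rev_cons choices_refl_rcons // -vE svV.
- move=> x ix; rewrite svV mulmxA; set y := x *m invmx v.
  have ys : y *m sr A.1 *m sr A.1 = y by rewrite -mulmxA sr_sq // mulmx1.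
  have ysA : y *m sr A.1 *m A.1 = - (y *m A.1) by rewrite -mulmxA sr_self // mulmxN.
  rewrite cost_cons /= cost_act // ys (mulmxDr _ (s_aff_vec A)) height2D [y *m _ *m (_ *m a)]mulmxA ys.
  rewrite !rev_cons total_rcons // -vE /= -/y -E // -/y.
  rewrite /s_aff_vec -scalemxAr height2Z ysA height2N.
  have -> : g_cost D z (y *m sr A.1) (- A.1) = g_cost D z y A.1.
    by rewrite /g_cost mulmxN ysA opprK.
  by ring.
Qed.

Lemma f_prod_factors As : (forall A, A \in As -> aff_root D A) ->
  factors [seq (true, A.1) | A <- As] (\prod_(A <- As) f_aff D k m A).
Proof.
elim: As => [|A As IH] rAs; first by rewrite big_nil; left.
have [rA _] : aff_root D A by apply: rAs; rewrite mem_head.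
rewrite big_cons f_affE; exists (Num.floor (m%:R * A.2)), (\prod_(B <- As) f_aff D k m B).
by split=> //; apply: IH => B BAs; apply: rAs; rewrite inE BAs orbT.
Qed.

Lemma ord_f_cost w As : in_W w -> (forall A, A \in As -> aff_root D A) ->
  exists2 c : int, ord_f D k m w z As = (c%:~R / 2)%:E &
    c%:~R = \sum_(A <- As) f_cost D z (invmx w) A.1.
Proof.
move=> ww rAs; have rL : root_list D [seq (true, A.1) | A <- As].
  by move=> _ /mapP[A /rAs[rA _] ->].
have [c cE E] := ord_kappa_factors m hz ww rL (f_prod_factors rAs) (in_P0 D).
by exists c => //; rewrite E mulmx0 height2_0 subr0 cost_f_factors.
Qed.

Lemma lee_half (c d : int) : (c%:~R : R) <= d%:~R ->
  ((c%:~R / 2 : rat)%:E <= (d%:~R / 2 : rat)%:E)%E.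
Proof. by rewrite ler_int lee_fin ler_pM2r ?invr_gt0 ?ltr0n // ler_int. Qed.

Lemma dr_fun_Gam g a : g != 0 ->
  dr_mul m (dr_fun g) (dr_Gam D k a) = dr_term g a 1%:M.
Proof.
move=> g0; apply: etrans (dr_mul_term m _ _ _ _ g0 (oner_neq0 _)) _.
by rewrite (W_act1 k (in_W1 D)) Gam_act1 mulr1 mul1mx add0r mul1mx.
Qed.

Lemma dr_fun_Gam_W g a v : g != 0 ->
  dr_mul m (dr_mul m (dr_fun g) (dr_Gam D k a)) (dr_W D k v) = dr_term g a v.
Proof.
move=> g0; apply: etrans (congr1 (dr_mul m ^~ (dr_W D k v)) (dr_fun_Gam a g0)) _.
apply: etrans (dr_mul_term m _ _ _ _ g0 (oner_neq0 _)) _.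
by rewrite (W_act1 k (in_W1 D)) Gam_act1 mulr1 mulmx0 addr0 mul1mx.
Qed.

Lemma dr_W_fun_Gam g a v : g != 0 ->
  dr_mul m (dr_W D k v) (dr_mul m (dr_fun g) (dr_Gam D k a)) =
  dr_term (Gam_act m 0 (W_act v g)) (v *m a) v.
Proof.
move=> g0; apply: etrans (congr1 (dr_mul m (dr_W D k v)) (dr_fun_Gam a g0)) _.
apply: etrans (dr_mul_term m _ _ _ _ (oner_neq0 _) g0) _.
by rewrite mul1r add0r mulmx1.
Qed.

Theorem ord_boundedP w As : in_W w -> (forall A, A \in As -> aff_root D A) ->
  cost_bounded D z 1 As -> ord_bounded D k m w z As.
Proof.
move=> ww rAs cb U /(expansion_plus rAs)[cs [L [a [v [g [[sz UE rL Lg] pa wv E]]]]]].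
have [c cE cE'] := ord_kappa_factors m hz ww rL Lg pa.
have [d dE dE'] := ord_f_cost ww rAs; have iw := in_W_isom (in_WV ww).
exists (ord_kappa m w z g a); last first.
  by rewrite cE dE lee_half // cE' dE' E // cb.
exists g, a, v; split=> //.
by rewrite UE dr_fun_Gam_W // (factors_neq0 hz rL Lg).
Qed.

Theorem dag_ord_boundedP w As : in_W w -> (forall A, A \in As -> aff_root D A) ->
  cost_bounded D z (-1) (rev As) -> dag_ord_bounded D k m w z As.
Proof.
move=> ww rAs cb U /(expansion_minus rAs)[cs [L [a [v [g [[sz UE rL Lg] pa wv vE E]]]]]].
have wV := in_WV wv; have iV := in_W_isom wV.
have [g1 Lg1 g1E] := factors_W_preim m wv rL Lg.
have rL1 := root_list_act iV rL; have pa1 := in_P_W wV pa.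
have [c cE cE'] := ord_kappa_factors m hz ww rL1 Lg1 pa1.
have [d dE dE'] := ord_f_cost ww rAs; have iw := in_W_isom (in_WV ww).
exists (ord_kappa m w z g1 (invmx v *m a)); last first.
  rewrite cE dE lee_half // cE' dE' cost_act // mulmxA E //.
  have := cb _ (rev cs) iw; rewrite !size_rev => /(_ sz); apply: le_trans.
  have e : perm_eq As (rev As) by rewrite perm_sym perm_rev.
  by rewrite (perm_big _ e).
exists g1, (invmx v *m a), v; split=> //.
rewrite UE (dr_W_fun_Gam _ _ (factors_neq0 hz rL1 Lg1)) g1E.
by rewrite mulKVmx // (isom_unit (in_W_isom wv)).
Qed.

End NormalForms.

Theorem proposition5p1 (R : realType) (n : nat) (D : rootData R n)
  (k : fieldType) (k_char0 : [pchar k] =i pred0)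
  (m : nat) (m_gt0 : (0 < m)%N)
  (m_denom : forall b c, in_P D b -> in_P D c ->
     m%:R * euclid (gram D) b c \is a Num.int)
  (w : 'M[R]_n) (hw : in_W D w) (z : R) (hz : z \in nuR D) :
  (forall (u : 'M[R]_n) (js : seq 'I_n) (r p : nat),
     u = word D (rev js) -> reduced D (rev js) ->
     (1 <= r)%N -> (r <= p)%N -> (p <= size js)%N ->
     let As := slice r p (root_seq D js) in
     let negAs := map (@aff_opp R n) As in
     [/\ ord_bounded D k m w z (rev As),
         ord_bounded D k m w z negAs,
         dag_ord_bounded D k m w z (rev As) &
         dag_ord_bounded D k m w z negAs]) /\
  (forall (b : 'cV[R]_n) (pi : aff -> aff) (js : seq 'I_n.+1) (p : nat),
     in_Pplus D b -> in_Pi D pi ->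
     transl D b =1 pi \o aff_word D (rev js) -> aff_reduced D (rev js) ->
     (1 <= p)%N -> (p <= size js)%N ->
     let As := slice 1 p (aff_root_seq D js) in
     ord_bounded D k m w z (rev As) /\
     dag_ord_bounded D k m w z (map (@aff_opp R n) As)).
Proof.
have ropp As : (forall A, A \in As -> aff_root D A) ->
    forall A, A \in map (@aff_opp R n) As -> aff_root D A.
  move=> rAs _ /mapP[A /rAs[rA [c E]] ->]; split; first by rewrite rootN.
  by exists (- c); rewrite /= nuN E rmorphN mulrN.
have rrev As : (forall A, A \in As -> aff_root D A) ->
    forall A, A \in rev As -> aff_root D A.
  by move=> rAs A; rewrite mem_rev; exact: rAs.
have rslice r p js A : A \in slice r p (aff_root_seq D js) -> aff_root D A.
  by move=> /mem_drop /mem_take; exact: ars_aff_root.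
split=> [u js r p _ red r0 rp ps As negAs|b pi js p bd hPi bE red _ ps As].
  have rAs A : A \in As -> aff_root D A.
    by rewrite /As root_seq_fin; exact: rslice.
  have [c1 c2 c3 c4] := finite_costs z red r0 rp ps.
  split.
  - exact: (ord_boundedP hz hw (rrev _ rAs) c1).
  - exact: (ord_boundedP hz hw (ropp _ rAs) c2).
  - by apply: (dag_ord_boundedP hz hw (rrev _ rAs)); rewrite revK.
  - exact: (dag_ord_boundedP hz hw (ropp _ rAs) c4).
have rAs A : A \in As -> aff_root D A by exact: rslice.
have [c1 c2] := dominant_costs z bd hPi bE red ps.
split; first exact: (ord_boundedP hz hw (rrev _ rAs) c1).
exact: (dag_ord_boundedP hz hw (ropp _ rAs) c2).
Qed.
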